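(* Let $X$ be a $\Delta$-closed subset of $\mathbb A^n$ defined over $F$. Then $X$ is $\Delta$-complete if and only if for every model $K$ of $DCF_{0,m}$ extending $F$ and every maximal $\Delta$-subring $R$ of $K$ containing $F$, every $K$-rational point of $X$ is an $R$-rational point of $X$ (i.e. $X(K)\subseteq R^n$).
   Context: $\Delta=\{\delta_1,\dots,\delta_m\}$ is a finite set of commuting derivations; $F$ is a model of $DCF_{0,m}$ (differentially closed field of characteristic $0$ with $m$ commuting derivations). $\Delta$-closed sets are zero sets of $\Delta$-polynomials (Kolchin topology). A $\Delta$-closed set $X$ is $\Delta$-complete if for every quasi-projective $\Delta$-variety $Y$, the projection $X\times Y\to Y$ maps $\Delta$-closed subsets of $X\times Y$ to $\Delta$-closed subsets of $Y$. For a $\Delta$-field $K$, let $H_K$ be the set of triples $(A,f,L)$ with $A$ a $\Delta$-subring of $K$, $L$ a $\Delta$-field and $f:A\to L$ a $\Delta$-homomorphism, ordered by $(A_1,f_1,L_1)\le(A_2,f_2,L_2)$ iff $A_1\subseteq A_2$, $L_1\subseteq L_2$ and $f_2|_{A_1}=f_1$. A maximal $\Delta$-subring of $K$ is the domain $A$ of a maximal element $(A,f,L)$ of $H_K$.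
   Formalization: A maximal element (A,f,L) of H_K is read as one whose domain A cannot be enlarged by any larger triple; read literally, L can always be enlarged, so no element would be maximal and the criterion would be vacuous. *)

(* Defs.v *)
From HB Require Import structures.
From mathcomp Require Import all_boot all_algebra.
From mathcomp Require Import finmap.
From mathcomp.multinomials Require Import monalg.
From mathcomp Require Import classical_sets.

Set Implicit Arguments.
Unset Strict Implicit.
Unset Printing Implicit Defensive.

Import GRing.Theory.
Local Open Scope ring_scope.
Local Open Scope classical_set_scope.

HB.mixin Record hasDerivations (m : nat) R of GRing.ComNzRing R := {
  delta : 'I_m -> R -> R;
  deltaD : forall i x y, delta i (x + y) = delta i x + delta i y;
  deltaM : forall i x y, delta i (x * y) = delta i x * y + x * delta i y;
  deltaC : forall i j x, delta i (delta j x) = delta j (delta i x)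
}.

#[short(type="diffRingType")]
HB.structure Definition DiffRing (m : nat) :=
  {R of GRing.ComNzRing R & hasDerivations m R}.

#[short(type="diffFieldType")]
HB.structure Definition DiffField (m : nat) :=
  {K of GRing.Field K & hasDerivations m K}.

Definition dmorphism (m : nat) (R S : diffRingType m) (f : R -> S) : Prop :=
  forall i x, f (delta i x) = delta i (f x).

(* theta a x = delta_0^(a 0) (delta_1^(a 1) (... x)) *)
Definition theta (m : nat) (R : diffRingType m) (a : {ffun 'I_m -> nat})
    (x : R) : R :=
  foldr (fun i y => iter (a i) (delta i) y) x (enum 'I_m).

(* The Delta-polynomial ring R{y_i | i : I}: polynomials over R in the         *)
(* algebraic indeterminates (i, a), standing for the derivative theta a y_i.   *)
Definition dpoly (m : nat) (R : diffRingType m) (I : choiceType) :=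
  {malg R[{cmonom (I * {ffun 'I_m -> nat})%type}]}.

Section Evaluation.
Variables (m : nat) (R S : diffRingType m) (I : choiceType).

Definition dmonom_eval (x : I -> S)
    (u : {cmonom (I * {ffun 'I_m -> nat})%type}) : S :=
  \prod_(v <- finsupp u) theta v.2 (x v.1) ^+ u v.

Definition deval (phi : R -> S) (x : I -> S) (p : dpoly R I) : S :=
  mmap phi (dmonom_eval x) p.

Definition dzeros (phi : R -> S) (P : set (dpoly R I)) : set (I -> S) :=
  [set x | forall p, P p -> deval phi x p = 0].

End Evaluation.

(* Models of DCF_{0,m}: the existentially closed Delta-fields of               *)
(* characteristic 0.                                                           *)
Definition DCF0 (m : nat) (K : diffFieldType m) : Prop :=
  [pchar K] =i pred0 /\
  forall (n : nat) (eqs neqs : seq (dpoly K 'I_n))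
         (L : diffFieldType m) (phi : {rmorphism K -> L}), dmorphism phi ->
    (exists x : 'I_n -> L,
       (forall p, p \in eqs -> deval phi x p = 0) /\
       (forall p, p \in neqs -> deval phi x p <> 0)) ->
    exists x : 'I_n -> K,
      (forall p, p \in eqs -> deval idfun x p = 0) /\
      (forall p, p \in neqs -> deval idfun x p <> 0).

(* p is Delta-homogeneous of degree d in the variables selected by w:          *)
(* p(t y) = t^d p(y) for t a Delta-indeterminate, i.e. for all values of t and *)
(* of the variables in all Delta-ring extensions of F.                         *)
Definition dhomog (m : nat) (F : diffFieldType m) (I : choiceType)
    (w : pred I) (d : nat) (p : dpoly F I) : Prop :=
  forall (S : diffRingType m) (phi : {rmorphism F -> S}), dmorphism phi ->
  forall (t : S) (x : I -> S),
    deval phi (fun i => if w i then t * x i else x i) p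
    = t ^+ d * deval phi x p.

(* Subsets of P^N(F) are given by their sets of homogeneous coordinate         *)
(* vectors, that is, by sets of nonzero vectors.                               *)
Section Projective.
Variables (m : nat) (F : diffFieldType m).

Definition proj_closed (N : nat) (C : set ('I_N.+1 -> F)) : Prop :=
  exists2 P : set (dpoly F 'I_N.+1),
    forall p, P p -> exists d, dhomog predT d p
  & C = [set y | exists i, y i <> 0] `&` dzeros idfun P.

Definition quasiproj (N : nat) (Y : set ('I_N.+1 -> F)) : Prop :=
  exists C D : set ('I_N.+1 -> F),
    [/\ proj_closed C, proj_closed D & Y = C `\` D].

Definition closed_in (N : nat) (Y W : set ('I_N.+1 -> F)) : Prop :=
  exists2 C, proj_closed C & W = Y `&` C.

Definition pair_coord (n N : nat) (x : 'I_n -> F) (y : 'I_N.+1 -> F)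
    (s : 'I_n + 'I_N.+1) : F :=
  match s with inl i => x i | inr j => y j end.

Definition is_proj_var (n N : nat) (s : 'I_n + 'I_N.+1) : bool :=
  if s is inr _ then true else false.

Definition prod_closed_in (n N : nat) (X : set ('I_n -> F))
    (Y : set ('I_N.+1 -> F)) (Z : set (('I_n -> F) * ('I_N.+1 -> F))) : Prop :=
  exists2 P : set (dpoly F ('I_n + 'I_N.+1)%type),
    forall p, P p -> exists d, dhomog (@is_proj_var n N) d p
  & Z = [set z | [/\ X z.1, Y z.2 &
                     dzeros idfun P (pair_coord z.1 z.2)]].

Definition dcomplete (n : nat) (X : set ('I_n -> F)) : Prop :=
  forall (N : nat) (Y : set ('I_N.+1 -> F)), quasiproj Y ->
  forall Z : set (('I_n -> F) * ('I_N.+1 -> F)), prod_closed_in X Y Z ->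
    closed_in Y (snd @` Z).

End Projective.

(* An element (A, f, L) of H_K. The homomorphism f : A -> L is represented by  *)
(* a function on K whose values outside A are irrelevant.                      *)
Record Htriple (m : nat) (K : diffFieldType m) := {
  Hdom : set K;
  Hcod : diffFieldType m;
  Hmap : K -> Hcod;
  Hdom1 : Hdom 1;
  HdomB : forall x y, Hdom x -> Hdom y -> Hdom (x - y);
  HdomM : forall x y, Hdom x -> Hdom y -> Hdom (x * y);
  Hdom_delta : forall i x, Hdom x -> Hdom (delta i x);
  Hmap1 : Hmap 1 = 1;
  HmapD : forall x y, Hdom x -> Hdom y -> Hmap (x + y) = Hmap x + Hmap y;
  HmapM : forall x y, Hdom x -> Hdom y -> Hmap (x * y) = Hmap x * Hmap y;
  Hmap_delta : forall i x, Hdom x -> Hmap (delta i x) = delta i (Hmap x)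
}.

(* The inclusion L_1 <= L_2 is a Delta-embedding j. *)
Definition Hle (m : nat) (K : diffFieldType m) (T1 T2 : Htriple K) : Prop :=
  Hdom T1 `<=` Hdom T2 /\
  exists2 j : {rmorphism Hcod T1 -> Hcod T2}, dmorphism j &
    forall x, Hdom T1 x -> Hmap T2 x = j (Hmap T1 x).

(* Every field L has proper Delta-extensions, so no triple is maximal in the   *)
(* literal sense; as usual, (A, f, L) is called maximal when f does not extend *)
(* to a strictly larger Delta-subring of K.                                    *)
Definition Hmaximal (m : nat) (K : diffFieldType m) (T : Htriple K) : Prop :=
  forall T', Hle T T' -> Hdom T' = Hdom T.

Definition maximal_dsubring (m : nat) (K : diffFieldType m) (A : set K) : Prop :=
  exists2 T : Htriple K, Hmaximal T & Hdom T = A.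

(* Main.v *)
Require Import Defs.
From HB Require Import structures.
From mathcomp Require Import all_boot all_algebra.
From mathcomp Require Import finmap generic_quotient ring.
From mathcomp.multinomials Require Import monalg.
From mathcomp Require Import boolp classical_sets filter.

(** If X is complete and x in X(K) is not R-rational for the maximal Delta-subring R of
    (R, f, L), let m = ker f.  Then 1 lies in the Delta-ideal m R{x}: otherwise
    R{x}/m R{x} tensored over R/m with L is a nonzero Delta-algebra over Q, hence maps to a
    Delta-field, and f extends to R{x}.  Writing 1 = sum_j m_j t_j(x), the point (m : 1) is in
    the projection of the closed set sum_j y_j t_j(x) = y_r of X x P^r.  This projection is
    closed and defined over F, so it contains the image (0 : 1) of (m : 1) under f, which is
    absurd.

    Conversely let y0 be in the closure of the projection of Z.  An ultrapower of F along the
    neighbourhoods of y0 contains a point (x, w) of Z such that w specializes to y0 over F.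
    Embed the ultrapower in a model K and extend F{w} -> F to a maximal triple; by the
    criterion x is in its domain, so that (x, w) is mapped to a point of Z over y0 in some
    Delta-field extension of F, and F is existentially closed.

    The last step concerns possibly infinite systems.  Instead of the Ritt-Raudenbush basis
    theorem we use that the Delta-ideal of a point a of a Delta-field extension of F is
    determined by finitely many equations and inequations: by Dickson's lemma the
    derivatives of a that are algebraic over the preceding ones (for a ranking) are
    derivatives of finitely many minimal such ones, and it suffices to take the minimal
    polynomials of the latter, with nonvanishing initials and separants. *)

Set Implicit Arguments.
Unset Strict Implicit.
Unset Printing Implicit Defensive.

Import GRing.Theory.
Local Open Scope ring_scope.
Local Open Scope classical_set_scope.
Local Open Scope quotient_scope.

(** Completeness speaks only of F-rational points, the criterion of points in extensions. Each
    passage between them specializes a point of an extension to an F-point, at times under one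
    prescribed inequation, and must respect infinitely many equations, since closed sets are zero
    sets of arbitrary sets of polynomials; hence the need for finite determination of the
    Delta-ideal of a point. The criterion tests models only, so the ultrapower has to be embedded in
    one; such a model is built by repeating a compactness argument countably often. Every
    Delta-field that is constructed is the fraction field of A/p for a prime Delta-ideal p of a
    Delta-ring A. Characteristic 0 does two jobs: nilradicals of Q-algebras are stable under
    derivations, so that nonzero Delta-algebras over Q map to Delta-fields, and the separant of a
    minimal polynomial does not vanish. The tensor product is nonzero because maximality makes R
    local: R/m is a field, so some R/m-linear functional on L sends 1 to 1. *)

Lemma In_map (T U : Type) (f : T -> U) s y : List.In y (map f s) ->
  exists2 x, List.In x s & f x = y.
Proof.
by elim: s => //= x s IH [<-|/IH[x' x's <-]]; [exists x; [left|]|exists x'; [right|]].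
Qed.

Lemma In_cat (T : Type) (s t : seq T) x :
  List.In x (s ++ t) <-> List.In x s \/ List.In x t.
Proof. by elim: s => [|y s IH] /=; [tauto|rewrite IH; tauto]. Qed.

(** * Delta-rings, Delta-homomorphisms on subrings, and Delta-terms *)

Section DiffRingTheory.
Variables (m : nat) (S : diffRingType m).
Implicit Types (x y : S) (i j : 'I_m).

Lemma delta0 i : delta i (0 : S) = 0.
Proof. by apply: (addrI (delta i (0 : S))); rewrite -deltaD !addr0. Qed.

Lemma deltaN i x : delta i (- x) = - delta i x.
Proof. by apply: (addrI (delta i x)); rewrite -deltaD !subrr delta0. Qed.

Lemma deltaB i x y : delta i (x - y) = delta i x - delta i y.
Proof. by rewrite deltaD deltaN. Qed.

Lemma delta1 i : delta i (1 : S) = 0.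
Proof.
have := deltaM i (1 : S) 1; rewrite !mulr1 mul1r => /eqP.
by rewrite -[X in X == _]addr0 (inj_eq (addrI _)) eq_sym => /eqP.
Qed.

Lemma deltaX i x n : delta i (x ^+ n.+1) = (x ^+ n * delta i x) *+ n.+1.
Proof.
elim: n => [|n IH]; first by rewrite !expr1 expr0 mul1r mulr1n.
rewrite exprS deltaM IH mulrnAr mulrA -exprS [in RHS]mulrS; congr (_ + _).
by rewrite mulrC.
Qed.

Lemma delta_iterC i j x k :
  delta i (iter k (delta j) x) = iter k (delta j) (delta i x).
Proof. by elim: k => //= k IH; rewrite deltaC IH. Qed.

Definition shift_ffun (a : {ffun 'I_m -> nat}) (j : 'I_m) : {ffun 'I_m -> nat} :=
  [ffun k => (a k + (k == j))%N].

Lemma theta0 x : theta [ffun=> 0%N] x = x.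
Proof.
by rewrite /theta; elim: (enum _) => //= i s ->; rewrite ffunE.
Qed.

(** [theta] applies the derivations in the fixed order of [enum]. As they commute, [delta j] moves
    inwards to the slot of [j], which occurs exactly once because [enum] has no repetitions. *)
Lemma theta_shift a j x : theta (shift_ffun a j) x = delta j (theta a x).
Proof.
rewrite /theta; have := enum_uniq 'I_m; have := mem_enum 'I_m j; rewrite inE.
elim: (enum _) => //= i s IH; rewrite inE => + /andP[is_ us]; case: eqVneq => [ji _|ji /= js].
  subst i.
  rewrite ffunE eqxx addn1 /=; congr delta; congr iter.
  elim: s is_ {us IH} => //= k s IH; rewrite inE negb_or => /andP[jk /IH ->].
  by rewrite ffunE [k == _]eq_sym (negPf jk) addn0.
by rewrite IH // ffunE [i == _]eq_sym (negPf ji) addn0 delta_iterC.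
Qed.

End DiffRingTheory.

(** The conditions on an element of H_K as a predicate on a function. With [A := setT] it also
    covers total homomorphisms, so coefficient embeddings and partial maps share one theory. *)
Record dhom_on (m : nat) (S S' : diffRingType m) (A : set S) (f : S -> S') : Prop :=
  DhomOn {
  dhom_dom1 : A 1;
  dhom_domB : forall x y, A x -> A y -> A (x - y);
  dhom_domM : forall x y, A x -> A y -> A (x * y);
  dhom_dom_delta : forall i x, A x -> A (delta i x);
  dhom1 : f 1 = 1;
  dhomD : forall x y, A x -> A y -> f (x + y) = f x + f y;
  dhomM : forall x y, A x -> A y -> f (x * y) = f x * f y;
  dhom_delta : forall i x, A x -> f (delta i x) = delta i (f x)
}.

Section DhomTheory.
Variables (m : nat) (S S' : diffRingType m) (A : set S) (f : S -> S').
Hypothesis fA : dhom_on A f.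

Lemma dhom_dom0 : A 0.
Proof. by have := dhom_domB fA (dhom_dom1 fA) (dhom_dom1 fA); rewrite subrr. Qed.

Lemma dhom_domN x : A x -> A (- x).
Proof. by move=> Ax; rewrite -sub0r; exact: dhom_domB fA _ _ dhom_dom0 Ax. Qed.

Lemma dhom_domD x y : A x -> A y -> A (x + y).
Proof.
by move=> Ax Ay; rewrite -[y]opprK; apply: (dhom_domB fA) => //; exact: dhom_domN.
Qed.

Lemma dhom0 : f 0 = 0.
Proof. by apply: (addrI (f 0)); rewrite -(dhomD fA) ?addr0 //; exact: dhom_dom0. Qed.

Lemma dhomN x : A x -> f (- x) = - f x.
Proof.
move=> Ax; apply: (addrI (f x)); rewrite -(dhomD fA) // ?subrr ?dhom0 //.
exact: dhom_domN.
Qed.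

Lemma dhomB x y : A x -> A y -> f (x - y) = f x - f y.
Proof. by move=> Ax Ay; rewrite (dhomD fA) ?dhomN //; exact: dhom_domN. Qed.

End DhomTheory.

Lemma dhom_onT (m : nat) (S S' : diffRingType m) (f : S -> S') :
  f 1 = 1 -> {morph f : x y / x + y} -> {morph f : x y / x * y} -> dmorphism f ->
  dhom_on setT f.
Proof. by move=> f1 fD fM fd; split. Qed.

Lemma dhom_rmorphism (m : nat) (S S' : diffRingType m) (f : {rmorphism S -> S'}) :
  dmorphism f -> dhom_on setT f.
Proof.
by move=> fd; apply: dhom_onT => //; [exact: rmorph1|exact: rmorphD|exact: rmorphM].
Qed.

(** Gives back the bundled morphisms that [DCF0] and [Hle] require. *)
Lemma rmorphism_of_dhom (m : nat) (S S' : diffRingType m) (f : S -> S') :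
  dhom_on setT f -> exists2 g : {rmorphism S -> S'}, dmorphism g & g =1 f.
Proof.
move=> fT; have fZ : zmod_morphism f by move=> x y; exact: (dhomB fT).
have fM : monoid_morphism f.
  by split; [exact: dhom1 fT | move=> x y; exact: (dhomM fT)].
pose zm := GRing.isZmodMorphism.Build S S' f fZ.
pose mm := GRing.isMonoidMorphism.Build S S' f fM.
pose g : {rmorphism S -> S'} := HB.pack f zm mm.
by exists g => // i x; exact: (dhom_delta fT).
Qed.

Lemma Htriple_dhom (m : nat) (K : diffFieldType m) (T : Htriple K) :
  dhom_on (Hdom T) (@Hmap m K T).
Proof.
split; [exact: Hdom1|exact: HdomB|exact: HdomM|exact: Hdom_delta|exact: Hmap1
       |exact: HmapD|exact: HmapM|exact: Hmap_delta].
Qed.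

Lemma dhom_comp (m : nat) (S S' S'' : diffRingType m) (A : set S')
    (g : S -> S') (f : S' -> S'') :
  dhom_on setT g -> dhom_on A f -> (forall x, A (g x)) -> dhom_on setT (f \o g).
Proof.
move=> gT fA gA; apply: dhom_onT => [|x y|x y|i x] /=.
- by rewrite (dhom1 gT) (dhom1 fA).
- by rewrite (dhomD gT) // (dhomD fA).
- by rewrite (dhomM gT) // (dhomM fA).
- by rewrite (dhom_delta gT) // (dhom_delta fA).
Qed.

Lemma dhom_idfun (m : nat) (S : diffRingType m) : dhom_on setT (@idfun S).
Proof. exact: dhom_onT. Qed.

Lemma dhom_natr (m : nat) (S S' : diffRingType m) (f : S -> S') k :
  dhom_on setT f -> f k%:R = k%:R.
Proof.
move=> fT; elim: k => [|k IH]; first exact: dhom0 fT.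
by rewrite -natr1 (dhomD fT) // IH (dhom1 fT) natr1.
Qed.

Lemma dhom_inj (m : nat) (K : diffFieldType m) (S : diffRingType m) (f : K -> S) :
  dhom_on setT f -> injective f.
Proof.
move=> fT x y fxy; apply/eqP; rewrite -subr_eq0; apply/negPn/negP => xy.
have : f ((x - y) * (x - y)^-1) = 0.
  by rewrite (dhomM fT) // (dhomB fT) // fxy subrr mul0r.
by rewrite divff // (dhom1 fT) => /eqP; rewrite oner_eq0.
Qed.

Lemma pchar0_natr_neq0 (K : fieldType) k : [pchar K] =i pred0 -> k.+1%:R != 0 :> K.
Proof. by move=> K0; have /pcharf0P -> := K0. Qed.

Lemma pchar0_dhom (m : nat) (K L : diffFieldType m) (f : K -> L) :
  dhom_on setT f -> [pchar K] =i pred0 -> [pchar L] =i pred0.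
Proof.
move=> fT K0; apply/pcharf0P => -[|k]; first by rewrite !eqxx.
apply/negbTE; rewrite -(dhom_natr _ fT); apply: contra (pchar0_natr_neq0 k K0).
by rewrite -{1}(dhom0 fT) => /eqP /(dhom_inj fT) ->.
Qed.

(** Syntactic stand-ins for Delta-polynomials: structural induction shows that evaluation commutes
    with partial homomorphisms, and coefficients and variables can be renamed by [tmap].
    Translations exist in both directions ([term_of_dpoly], [dpoly_of_dterm]). *)
Inductive dterm (m : nat) (C I : Type) : Type :=
| TC of C
| TV of I
| TD of 'I_m & dterm m C I
| TA of dterm m C I & dterm m C I
| TM of dterm m C I & dterm m C I.
Arguments TC {m C I}. Arguments TV {m C I}. Arguments TD {m C I}.
Arguments TA {m C I}. Arguments TM {m C I}.

Fixpoint teval (m : nat) (C I : Type) (S : diffRingType m) (phi : C -> S) (x : I -> S)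
    (t : dterm m C I) : S :=
  match t with
  | TC c => phi c
  | TV i => x i
  | TD j t => delta j (teval phi x t)
  | TA t u => teval phi x t + teval phi x u
  | TM t u => teval phi x t * teval phi x u
  end.

Section TermEval.
Variables (m : nat) (C I : Type).

Lemma eq_teval (S : diffRingType m) (phi phi' : C -> S) (x x' : I -> S) t :
  phi =1 phi' -> x =1 x' -> teval phi x t = teval phi' x' t.
Proof. by move=> ep ex; elim: t => //= [i t ->|t -> u ->|t -> u ->]. Qed.

Lemma teval_dom (S S' : diffRingType m) (A : set S) (f : S -> S') (phi : C -> S)
    (x : I -> S) t :
  dhom_on A f -> (forall c, A (phi c)) -> (forall i, A (x i)) -> A (teval phi x t).
Proof.
move=> fA pA xA; elim: t => //= [i t /(dhom_dom_delta fA)//|t tA u uA|t tA u uA].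
  exact: (dhom_domD fA).
exact: (dhom_domM fA).
Qed.

Lemma teval_dhom (S S' : diffRingType m) (A : set S) (f : S -> S') (phi : C -> S)
    (x : I -> S) t :
  dhom_on A f -> (forall c, A (phi c)) -> (forall i, A (x i)) ->
  f (teval phi x t) = teval (f \o phi) (f \o x) t.
Proof.
move=> fA pA xA; have tA u := teval_dom u fA pA xA.
elim: t => //= [i t <-|t <- u <-|t <- u <-].
- exact: (dhom_delta fA).
- exact: (dhomD fA).
- exact: (dhomM fA).
Qed.

End TermEval.

Fixpoint tmap (m : nat) (C C' I I' : Type) (f : C -> C') (g : I -> I') (t : dterm m C I) :
    dterm m C' I' :=
  match t with
  | TC c => TC (f c)
  | TV i => TV (g i)
  | TD j t => TD j (tmap f g t)
  | TA t u => TA (tmap f g t) (tmap f g u)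
  | TM t u => TM (tmap f g t) (tmap f g u)
  end.

Lemma teval_tmap (m : nat) (C C' I I' : Type) (f : C -> C') (g : I -> I')
    (S : diffRingType m) (phi : C' -> S) (x : I' -> S) t :
  teval phi x (tmap f g t) = teval (phi \o f) (x \o g) t.
Proof. by elim: t => //= [i t ->|t -> u ->|t -> u ->]. Qed.

Section TermsAndPolynomials.
Variables (m : nat) (F : diffFieldType m) (I : choiceType).
Local Notation V := (I * {ffun 'I_m -> nat})%type.

Definition tsum (ts : seq (dterm m F I)) := foldr TA (TC 0) ts.
Definition tprod (ts : seq (dterm m F I)) := foldr TM (TC 1) ts.
Definition texp t k := tprod (nseq k t).
Definition ttheta (v : V) : dterm m F I :=
  foldr (fun i y => iter (v.2 i) (TD i) y) (TV v.1) (enum 'I_m).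

Variables (S : diffRingType m) (phi : F -> S) (x : I -> S).
Hypothesis phiT : dhom_on setT phi.

Lemma teval_tsum ts : teval phi x (tsum ts) = \sum_(t <- ts) teval phi x t.
Proof.
by elim: ts => [|t ts IH] /=; rewrite ?big_nil ?(dhom0 phiT) // big_cons IH.
Qed.

Lemma teval_tprod ts : teval phi x (tprod ts) = \prod_(t <- ts) teval phi x t.
Proof.
by elim: ts => [|t ts IH] /=; rewrite ?big_nil ?(dhom1 phiT) // big_cons IH.
Qed.

Lemma teval_texp t k : teval phi x (texp t k) = teval phi x t ^+ k.
Proof.
by rewrite teval_tprod; elim: k => [|k IH] /=; rewrite ?big_nil // big_cons IH exprS.
Qed.

Lemma teval_ttheta v : teval phi x (ttheta v) = theta v.2 (x v.1).
Proof.
rewrite /ttheta /theta; elim: (enum _) => //= i s <-.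
by elim: (v.2 i) => //= k ->.
Qed.

Definition term_of_dpoly (p : dpoly F I) : dterm m F I :=
  tsum [seq TM (TC p@_u)
    (tprod [seq texp (ttheta v) (u v) | v <- enum_fset (finsupp u)])
    | u <- enum_fset (msupp p)].

Lemma deval_term p : deval phi x p = teval phi x (term_of_dpoly p).
Proof.
rewrite /deval mmapE teval_tsum big_map; apply: eq_bigr => u _ /=; congr (_ * _).
rewrite /dmonom_eval teval_tprod big_map; apply: eq_bigr => v _.
by rewrite teval_texp teval_ttheta.
Qed.

End TermsAndPolynomials.

(** * Residue fields of prime Delta-ideals *)

Record dprime (m : nat) (S : diffRingType m) := DPrime {
  dp_ring : set S;
  dp_ideal : set S;
  dp_ring1 : dp_ring 1;
  dp_ringB : forall x y, dp_ring x -> dp_ring y -> dp_ring (x - y);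
  dp_ringM : forall x y, dp_ring x -> dp_ring y -> dp_ring (x * y);
  dp_ring_delta : forall i x, dp_ring x -> dp_ring (delta i x);
  dp_sub : dp_ideal `<=` dp_ring;
  dp_ideal0 : dp_ideal 0;
  dp_idealB : forall x y, dp_ideal x -> dp_ideal y -> dp_ideal (x - y);
  dp_idealM : forall x y, dp_ring x -> dp_ideal y -> dp_ideal (x * y);
  dp_ideal_delta : forall i x, dp_ideal x -> dp_ideal (delta i x);
  dp_proper : ~ dp_ideal 1;
  dp_prime : forall x y, dp_ring x -> dp_ring y -> dp_ideal (x * y) ->
    dp_ideal x \/ dp_ideal y
}.

Section ResidueField.
Variables (m : nat) (S : diffRingType m) (d : dprime S).
Local Notation A := (dp_ring d).
Local Notation p := (dp_ideal d).

Lemma dp_dhom : dhom_on A (@idfun S).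
Proof. by split=> //; [exact: dp_ring1|exact: dp_ringB|exact: dp_ringM|exact: dp_ring_delta]. Qed.

Let A0 := dhom_dom0 dp_dhom.
Let A1 := dp_ring1 d.
Let AN := @dhom_domN _ _ _ _ _ dp_dhom.
Let AD := @dhom_domD _ _ _ _ _ dp_dhom.
Let AB := @dp_ringB _ _ d.
Let AM := @dp_ringM _ _ d.
Let Ad := @dp_ring_delta _ _ d.

Let p0 := dp_ideal0 d.
Let pB := @dp_idealB _ _ d.
Let pM := @dp_idealM _ _ d.

Let pN x : p x -> p (- x).
Proof. by move=> px; rewrite -sub0r; exact: pB. Qed.

Let pD x y : p x -> p y -> p (x + y).
Proof. by move=> px py; rewrite -[y]opprK; apply: pB => //; exact: pN. Qed.

Let pE x y : p x -> y = x -> p y.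
Proof. by move=> px ->. Qed.

Let npM x y : A x -> A y -> ~ p x -> ~ p y -> ~ p (x * y).
Proof. by move=> Ax Ay px py /(dp_prime Ax Ay)[]. Qed.

Definition frac_pre := {q : S * S | `[< [/\ A q.1, A q.2 & ~ p q.2] >]}.
HB.instance Definition _ := Choice.on frac_pre.

Lemma frac_preP (q : frac_pre) : [/\ A (val q).1, A (val q).2 & ~ p (val q).2].
Proof. by case: q => q /= /asboolP. Qed.

Definition mkfrac a b (Aa : A a) (Ab : A b) (pb : ~ p b) : frac_pre.
Proof. by exists (a, b); apply/asboolP. Defined.

(** Equality of fractions over A/p: the cross difference need only lie in p, so quotient and
    localization are carried out in one step. *)
Definition frac_eqv (q r : frac_pre) : bool :=
  `[< p ((val q).1 * (val r).2 - (val r).1 * (val q).2) >].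

Lemma frac_eqv_equiv : equiv_class_of frac_eqv.
Proof.
split=> [q|q r|q r s].
- by apply/asboolP; rewrite subrr.
- by apply: asbool_equiv_eq; split=> /pN; rewrite opprB.
move: q r s => q r s /asboolP rq /asboolP qs; apply/asboolP.
case: (frac_preP q) (frac_preP r) (frac_preP s) rq qs.
case: (val q) (val r) (val s) => [a b] [a' b'] [a'' b''] /= Aa Ab pb [Aa' Ab' pb'] [Aa'' Ab'' pb''] h1 h2.
(* The denominator [b] of the middle fraction lies outside p, so primality cancels it. *)
suff: p (b * (a' * b'' - a'' * b')) by case/dp_prime => //; apply: AB; apply: AM.
by apply: pE (pD (pM Ab'' h1) (pM Ab' h2)) _; ring.
Qed.

Canonical frac_equiv := EquivRelPack frac_eqv_equiv.

Definition frac := {eq_quot frac_equiv}.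
HB.instance Definition _ := Choice.on frac.
HB.instance Definition _ := EqQuotient.on frac.

Lemma fracP (q r : frac_pre) : (\pi_frac q = \pi_frac r) <->
  p ((val q).1 * (val r).2 - (val r).1 * (val q).2).
Proof. by split=> [/eqquotP/asboolP|h] //; apply/eqquotP/asboolP. Qed.

Definition pre_add (q r : frac_pre) : frac_pre :=
  let: And3 Aa Ab pb := frac_preP q in let: And3 Ac Ad pd := frac_preP r in
  mkfrac (AD (AM Aa Ad) (AM Ac Ab)) (AM Ab Ad) (npM Ab Ad pb pd).

Lemma pre_addE q r : val (pre_add q r) =
  ((val q).1 * (val r).2 + (val r).1 * (val q).2, (val q).2 * (val r).2).
Proof. by rewrite /pre_add; case: frac_preP => ???; case: frac_preP. Qed.

Definition pre_mul (q r : frac_pre) : frac_pre :=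
  let: And3 Aa Ab pb := frac_preP q in let: And3 Ac Ad pd := frac_preP r in
  mkfrac (AM Aa Ac) (AM Ab Ad) (npM Ab Ad pb pd).

Lemma pre_mulE q r : val (pre_mul q r) =
  ((val q).1 * (val r).1, (val q).2 * (val r).2).
Proof. by rewrite /pre_mul; case: frac_preP => ???; case: frac_preP. Qed.

Definition pre_opp (q : frac_pre) : frac_pre :=
  let: And3 Aa Ab pb := frac_preP q in mkfrac (AN Aa) Ab pb.

Lemma pre_oppE q : val (pre_opp q) = (- (val q).1, (val q).2).
Proof. by rewrite /pre_opp; case: frac_preP. Qed.

Definition pre_delta i (q : frac_pre) : frac_pre :=
  let: And3 Aa Ab pb := frac_preP q in
  mkfrac (AB (AM (Ad i Aa) Ab) (AM Aa (Ad i Ab))) (AM Ab Ab) (npM Ab Ab pb pb).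

Lemma pre_deltaE i q : val (pre_delta i q) =
  (delta i (val q).1 * (val q).2 - (val q).1 * delta i (val q).2,
   (val q).2 * (val q).2).
Proof. by rewrite /pre_delta; case: frac_preP. Qed.

Definition pre_of (a : S) : frac_pre :=
  match pselect (A a) with
  | left Aa => mkfrac Aa A1 (@dp_proper _ _ d)
  | right _ => mkfrac A0 A1 (@dp_proper _ _ d)
  end.

Lemma pre_ofE a : A a -> val (pre_of a) = (a, 1).
Proof. by rewrite /pre_of; case: pselect. Qed.

Definition pre_inv (q : frac_pre) : frac_pre :=
  let: And3 Aa Ab pb := frac_preP q in
  match pselect (p (val q).1) with
  | left _ => pre_of 0
  | right pa => mkfrac Ab Aa pa
  end.

Lemma pre_invE q : val (pre_inv q) =
  if `[< p (val q).1 >] then (0, 1) else ((val q).2, (val q).1).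
Proof.
rewrite /pre_inv; case: frac_preP => ???.
by case: pselect => [h|h]; case: asboolP => //; rewrite pre_ofE.
Qed.

Lemma fracW (P : frac -> Prop) : (forall q, P (\pi_frac q)) -> forall x, P x.
Proof. by move=> Pq x; rewrite -(reprK x). Qed.

Definition frac_add (x y : frac) : frac := \pi_frac (pre_add (repr x) (repr y)).
Definition frac_mul (x y : frac) : frac := \pi_frac (pre_mul (repr x) (repr y)).
Definition frac_opp (x : frac) : frac := \pi_frac (pre_opp (repr x)).
Definition frac_inv (x : frac) : frac := \pi_frac (pre_inv (repr x)).
Definition frac_delta i (x : frac) : frac := \pi_frac (pre_delta i (repr x)).
Definition frac_of (a : S) : frac := \pi_frac (pre_of a).

Let repr_eqv (q : frac_pre) : p ((val (repr (\pi_frac q))).1 * (val q).2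
  - (val q).1 * (val (repr (\pi_frac q))).2).
Proof. by apply/fracP; rewrite reprK. Qed.

Lemma frac_add_pi q r : frac_add (\pi_frac q) (\pi_frac r) = \pi_frac (pre_add q r).
Proof.
apply/fracP; rewrite !pre_addE; move: (repr_eqv q) (repr_eqv r).
case: (frac_preP (repr (\pi_frac q))) (frac_preP (repr (\pi_frac r))).
case: (frac_preP q) (frac_preP r).
case: (val q) (val r) (val (repr (\pi_frac q))) (val (repr (\pi_frac r))).
move=> a b [c e] [a' b'] [c' e'] /= ?? _ [?? _] ?? _ [?? _] h1 h2.
by apply: pE (pD (pM (AM (_ : A e) (_ : A e')) h1) (pM (AM (_ : A b) (_ : A b')) h2)) _ => //; ring.
Qed.

Lemma frac_mul_pi q r : frac_mul (\pi_frac q) (\pi_frac r) = \pi_frac (pre_mul q r).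
Proof.
apply/fracP; rewrite !pre_mulE; move: (repr_eqv q) (repr_eqv r).
case: (frac_preP (repr (\pi_frac q))) (frac_preP (repr (\pi_frac r))).
case: (frac_preP q) (frac_preP r).
case: (val q) (val r) (val (repr (\pi_frac q))) (val (repr (\pi_frac r))).
move=> a b [c e] [a' b'] [c' e'] /= ?? _ [?? _] ?? _ [?? _] h1 h2.
by apply: pE (pD (pM (AM (_ : A c') (_ : A e)) h1) (pM (AM (_ : A a) (_ : A b')) h2)) _ => //; ring.
Qed.

Lemma frac_opp_pi q : frac_opp (\pi_frac q) = \pi_frac (pre_opp q).
Proof.
by apply/fracP; rewrite !pre_oppE; apply: pE (pN (repr_eqv q)) _ => /=; ring.
Qed.

Lemma frac_delta_pi i q : frac_delta i (\pi_frac q) = \pi_frac (pre_delta i q).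
Proof.
apply/fracP; rewrite !pre_deltaE; move: (repr_eqv q).
case: (frac_preP (repr (\pi_frac q))) (frac_preP q).
case: (val q) (val (repr (\pi_frac q))) => a b [a' b'] /= ?? _ [?? _] h.
have h' := dp_ideal_delta i h.
(* With u the cross difference and v the product of the denominators, the cross difference of the
   two derivatives is v delta(u) - u delta(v), the numerator of the derivative of u/v. *)
apply: pE (pB (pM (AM (_ : A b) (_ : A b')) h') (pM (Ad i (AM (_ : A b) (_ : A b'))) h)) _ => //.
by rewrite deltaB !deltaM; ring.
Qed.

Lemma frac_inv_pi q : frac_inv (\pi_frac q) = \pi_frac (pre_inv q).
Proof.
apply/fracP; rewrite !pre_invE; move: (repr_eqv q).
case: (frac_preP (repr (\pi_frac q))) (frac_preP q).
case: (val q) (val (repr (\pi_frac q))) => a b [a' b'] /= Aa' Ab' pb' [Aa Ab pb] h.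
case: asboolP => pa'; case: asboolP => pa /=.
- by rewrite mul0r subrr.
- case: (dp_prime Aa Ab' _) => //.
  by apply: pE (pB (pM Ab pa') h) _; ring.
- case: (dp_prime Aa' Ab _) => //.
  by apply: pE (pD (pM Ab' pa) h) _; ring.
- by apply: pE (pN h) _; ring.
Qed.

Ltac frac_ring := apply/fracP;
  rewrite ?(pre_addE, pre_mulE, pre_oppE, pre_deltaE, pre_ofE A0, pre_ofE A1) /=;
  apply: pE p0 _; rewrite ?(deltaB, deltaD, deltaM, delta0, delta1); ring.

Lemma frac_addA : associative frac_add.
Proof.
move=> x y z; elim/fracW: x => x; elim/fracW: y => y; elim/fracW: z => z.
by rewrite !frac_add_pi; frac_ring.
Qed.

Lemma frac_addC : commutative frac_add.
Proof.
move=> x y; elim/fracW: x => x; elim/fracW: y => y.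
by rewrite !frac_add_pi; frac_ring.
Qed.

Lemma frac_add0 : left_id (frac_of 0) frac_add.
Proof. by move=> x; elim/fracW: x => x; rewrite !frac_add_pi; frac_ring. Qed.

Lemma frac_addN : left_inverse (frac_of 0) frac_opp frac_add.
Proof. by move=> x; elim/fracW: x => x; rewrite frac_opp_pi !frac_add_pi; frac_ring. Qed.

HB.instance Definition _ := GRing.isZmodule.Build frac
  frac_addA frac_addC frac_add0 frac_addN.

Lemma frac_mulA : associative frac_mul.
Proof.
move=> x y z; elim/fracW: x => x; elim/fracW: y => y; elim/fracW: z => z.
by rewrite !frac_mul_pi; frac_ring.
Qed.

Lemma frac_mulC : commutative frac_mul.
Proof.
move=> x y; elim/fracW: x => x; elim/fracW: y => y.
by rewrite !frac_mul_pi; frac_ring.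
Qed.

Lemma frac_mul1 : left_id (frac_of 1) frac_mul.
Proof. by move=> x; elim/fracW: x => x; rewrite !frac_mul_pi; frac_ring. Qed.

Lemma frac_mulDl : left_distributive frac_mul frac_add.
Proof.
move=> x y z; elim/fracW: x => x; elim/fracW: y => y; elim/fracW: z => z.
by rewrite !(frac_mul_pi, frac_add_pi); frac_ring.
Qed.

Lemma frac_of_eq0 a : A a -> frac_of a = frac_of 0 <-> p a.
Proof. by move=> Aa; rewrite fracP !pre_ofE //= mulr1 mul0r subr0. Qed.

Lemma frac_1neq0 : frac_of 1 != frac_of 0.
Proof. by apply/eqP => /(frac_of_eq0 A1); exact: dp_proper. Qed.

HB.instance Definition _ := GRing.Zmodule_isComNzRing.Build frac
  frac_mulA frac_mulC frac_mul1 frac_mulDl frac_1neq0.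

Lemma frac_mulV (x : frac) : x != 0 -> frac_inv x * x = 1.
Proof.
elim/fracW: x => q q0; rewrite frac_inv_pi [LHS]frac_mul_pi; apply/fracP.
rewrite pre_mulE pre_invE pre_ofE //=; case: asboolP => [pq|_ /=].
  case/eqP: q0; apply/fracP; rewrite pre_ofE //=.
  by rewrite mul0r mulr1 subr0.
by apply: pE p0 _; ring.
Qed.

Lemma frac_inv0 : frac_inv (0 : frac) = 0.
Proof.
rewrite frac_inv_pi; apply/fracP; rewrite pre_invE !pre_ofE //=.
by case: asboolP => //= _; rewrite mul0r subrr.
Qed.

HB.instance Definition _ := GRing.ComNzRing_isField.Build frac frac_mulV frac_inv0.

Lemma frac_deltaD i (x y : frac) :
  frac_delta i (x + y) = frac_delta i x + frac_delta i y.
Proof.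
elim/fracW: x => x; elim/fracW: y => y; rewrite [x in frac_delta i x]frac_add_pi !frac_delta_pi.
by rewrite [RHS]frac_add_pi; frac_ring.
Qed.

Lemma frac_deltaM i (x y : frac) :
  frac_delta i (x * y) = frac_delta i x * y + x * frac_delta i y.
Proof.
elim/fracW: x => x; elim/fracW: y => y; rewrite [x in frac_delta i x]frac_mul_pi !frac_delta_pi.
rewrite [X in X + _]frac_mul_pi [X in _ + X]frac_mul_pi [RHS]frac_add_pi.
by frac_ring.
Qed.

Lemma frac_deltaC i j (x : frac) :
  frac_delta i (frac_delta j x) = frac_delta j (frac_delta i x).
Proof.
elim/fracW: x => x; rewrite !frac_delta_pi; apply/fracP; rewrite !pre_deltaE /=.
by apply: pE p0 _; rewrite ?(deltaB, deltaM) !(deltaC i j); ring.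
Qed.

HB.instance Definition _ := hasDerivations.Build m frac frac_deltaD frac_deltaM frac_deltaC.

Lemma frac_of_dhom : dhom_on A (frac_of : S -> frac).
Proof.
split=> // [x y Ax Ay|x y Ax Ay|i x Ax].
- rewrite [RHS]frac_add_pi; apply/fracP; rewrite pre_addE !pre_ofE //; last exact: AD.
  by apply: pE p0 _ => /=; ring.
- rewrite [RHS]frac_mul_pi; apply/fracP; rewrite pre_mulE !pre_ofE //; last exact: AM.
  by apply: pE p0 _ => /=; ring.
- rewrite [RHS]frac_delta_pi; apply/fracP; rewrite pre_deltaE !pre_ofE //; last exact: Ad.
  by apply: pE p0 _ => /=; rewrite delta1; ring.
Qed.

Lemma frac_of_div (x : frac) : exists a b, [/\ A a, A b, ~ p b & x = frac_of a / frac_of b].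
Proof.
elim/fracW: x => q; case: (frac_preP q) => Aa Ab pb.
exists (val q).1, (val q).2; split=> //.
rewrite [X in _ * X]frac_inv_pi [RHS]frac_mul_pi; apply/fracP.
rewrite pre_mulE pre_invE !pre_ofE //=; case: asboolP => // _ /=.
by apply: pE p0 _; ring.
Qed.

End ResidueField.

(** The ideal lives in a subring of [S]. Taking all of a product gives ultraproducts, the eventually
    coherent sequences give direct limits, and a subring of a field gives the codomain of a maximal
    triple. *)
Lemma residue_field (m : nat) (S : diffRingType m) (d : dprime S) :
  exists (L : diffFieldType m) (f : S -> L),
  [/\ dhom_on (dp_ring d) f, forall x, dp_ring d x -> f x = 0 <-> dp_ideal d x &
    forall l : L, exists a b, [/\ dp_ring d a, dp_ring d b, ~ dp_ideal d b & l = f a / f b]].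
Proof.
exists (frac d), (frac_of d : S -> frac d); split.
- exact: frac_of_dhom.
- by move=> x Ax; exact: frac_of_eq0.
- exact: frac_of_div.
Qed.

(** * Ultraproducts and prime Delta-ideals *)

Lemma zorn_above (T : Type) (P : set (set T)) (W0 : set T) : P W0 ->
  (forall C : set (set T), C !=set0 -> C `<=` P -> total_on C subset ->
     P (\bigcup_(X in C) X)) ->
  exists W, [/\ P W, W0 `<=` W & forall W', P W' -> W `<=` W' -> W' `<=` W].
Proof.
move=> PW0 chainP; pose Q W := W = set0 \/ (P W /\ W0 `<=` W).
have [|A [QA maxA]] := @Zorn_bigcup T Q.
  move=> C CQ totC; pose C' := C `&` [set X | P X /\ W0 `<=` X].
  have [[X C'X]|C'0] := pselect (C' !=set0); last first.
    left; apply/seteqP; split=> // z [X CX Xz].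
    by case: (CQ _ CX) => [X0|PX]; [rewrite X0 in Xz|case: C'0; exists X].
  have -> : \bigcup_(X in C) X = \bigcup_(X in C') X.
    apply/seteqP; split=> z [Y CY Yz]; last by exists Y => //; case: CY.
    by exists Y => //; split=> //; case: (CQ _ CY) => // Y0; rewrite Y0 in Yz.
  right; split.
    apply: chainP; [by exists X|by move=> Y [_ [PY _]]|].
    by move=> Y Z [CY _] [CZ _]; exact: totC.
  by move=> z /(proj2 (proj2 C'X)) Xz; exists X.
have [PA W0A] : P A /\ W0 `<=` A.
  case: QA => // A0; have [W00|W0n] := pselect (W0 = set0).
    by rewrite A0 -W00; split=> [//|z].
  have /maxA[] : A `<` W0; last by right; split=> [//|z].
  by rewrite A0; split=> // W0s; case: W0n; apply/seteqP; split.
exists A; split=> // W' PW' AW'; apply: contrapT => W'A.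
by have /maxA[] : A `<` W'; [split|right; split=> //; exact: subset_trans AW'].
Qed.

Section ProductRing.
Variables (m : nat) (I : Type) (K : I -> diffRingType m) (i0 : I).

(* The index [i0] only serves to make the product ring nontrivial. *)
Definition dprod (_ : I) : Type := forall i, K i.
Local Notation prodK := (dprod i0).
HB.instance Definition _ := Choice.copy prodK (forall i, K i).

Definition dprod_add (a b : prodK) : prodK := fun i => a i + b i.
Definition dprod_mul (a b : prodK) : prodK := fun i => a i * b i.
Definition dprod_opp (a : prodK) : prodK := fun i => - a i.
Definition dprod_delta j (a : prodK) : prodK := fun i => delta j (a i).

Lemma dprod_addA : associative dprod_add.
Proof. by move=> a b c; apply: functional_extensionality_dep => i; exact: addrA. Qed.

Lemma dprod_addC : commutative dprod_add.
Proof. by move=> a b; apply: functional_extensionality_dep => i; exact: addrC. Qed.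

Lemma dprod_add0 : left_id ((fun=> 0) : prodK) dprod_add.
Proof. by move=> a; apply: functional_extensionality_dep => i; exact: add0r. Qed.

Lemma dprod_addN : left_inverse ((fun=> 0) : prodK) dprod_opp dprod_add.
Proof. by move=> a; apply: functional_extensionality_dep => i; exact: addNr. Qed.

HB.instance Definition _ := GRing.isZmodule.Build prodK
  dprod_addA dprod_addC dprod_add0 dprod_addN.

Lemma dprod_mulA : associative dprod_mul.
Proof. by move=> a b c; apply: functional_extensionality_dep => i; exact: mulrA. Qed.

Lemma dprod_mulC : commutative dprod_mul.
Proof. by move=> a b; apply: functional_extensionality_dep => i; exact: mulrC. Qed.

Lemma dprod_mul1 : left_id ((fun=> 1) : prodK) dprod_mul.
Proof. by move=> a; apply: functional_extensionality_dep => i; exact: mul1r. Qed.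

Lemma dprod_mulDl : left_distributive dprod_mul dprod_add.
Proof. by move=> a b c; apply: functional_extensionality_dep => i; exact: mulrDl. Qed.

Lemma dprod_1neq0 : ((fun=> 1) : prodK) != ((fun=> 0) : prodK).
Proof. by apply/eqP => /(congr1 (fun a : prodK => a i0)) /eqP; rewrite oner_eq0. Qed.

HB.instance Definition _ := GRing.Zmodule_isComNzRing.Build prodK
  dprod_mulA dprod_mulC dprod_mul1 dprod_mulDl dprod_1neq0.

Lemma dprod_deltaD j (a b : prodK) : dprod_delta j (a + b) = dprod_delta j a + dprod_delta j b.
Proof. by apply: functional_extensionality_dep => i; exact: deltaD. Qed.

Lemma dprod_deltaM j (a b : prodK) :
  dprod_delta j (a * b) = dprod_delta j a * b + a * dprod_delta j b.
Proof. by apply: functional_extensionality_dep => i; exact: deltaM. Qed.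

Lemma dprod_deltaC j k (a : prodK) :
  dprod_delta j (dprod_delta k a) = dprod_delta k (dprod_delta j a).
Proof. by apply: functional_extensionality_dep => i; exact: deltaC. Qed.

HB.instance Definition _ := hasDerivations.Build m prodK dprod_deltaD dprod_deltaM dprod_deltaC.

Lemma dprod_proj_dhom i : dhom_on setT (fun a : prodK => a i).
Proof. exact: dhom_onT. Qed.

Lemma dprod_dhom (S : diffRingType m) (phi : forall i, S -> K i) :
  (forall i, dhom_on setT (phi i)) -> dhom_on setT ((fun c i => phi i c) : S -> prodK).
Proof.
move=> phiT; apply: dhom_onT => [|x y|x y|j x]; apply: functional_extensionality_dep => i.
- exact: dhom1 (phiT i).
- exact: (dhomD (phiT i)).
- exact: (dhomM (phiT i)).
- exact: (dhom_delta (phiT i)).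
Qed.

Lemma teval_dprod (C J : Type) (phi : C -> prodK) (x : J -> prodK) t i :
  (teval phi x t) i = teval (fun c => phi c i) (fun j => x j i) t.
Proof. exact: (teval_dhom _ (dprod_proj_dhom i)). Qed.

End ProductRing.

Lemma residue_fieldT (m : nat) (S : diffRingType m) (p : set S) :
  p 0 -> (forall x y, p x -> p y -> p (x - y)) -> (forall x y, p y -> p (x * y)) ->
  (forall i x, p x -> p (delta i x)) -> ~ p 1 ->
  (forall x y, p (x * y) -> p x \/ p y) ->
  exists (L : diffFieldType m) (f : S -> L),
    dhom_on setT f /\ forall x, f x = 0 <-> p x.
Proof.
move=> p0 pB pM pd p1 pP.
have [L [f [fT fp _]]] := residue_field (@DPrime m S setT p Logic.I (fun _ _ _ _ => Logic.I)
  (fun _ _ _ _ => Logic.I) (fun _ _ _ => Logic.I) (fun _ _ => Logic.I) p0 pB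
  (fun x y _ => @pM x y) pd p1 (fun x y _ _ => @pP x y)).
by exists L, f; split=> // x; exact: fp.
Qed.

(** Elements vanishing on a [U]-large index set form a Delta-ideal of the product, prime because an
    ultrafilter contains each set or its complement. The equivalence is the theorem of Los for
    equations, and by negation for inequations. *)
Lemma ultraproduct (m : nat) (I : Type) (K : I -> diffFieldType m) (U : set_system I) :
  UltraFilter U ->
  exists (i0 : I) (L : diffFieldType m) (f : dprod K i0 -> L),
    dhom_on setT f /\ forall a, f a = 0 <-> U [set i | a i = 0].
Proof.
move=> UU; have [i0 _] := @filter_ex _ U _ _ filterT.
pose p : set (dprod K i0) := [set a | U [set i | a i = 0]].
have pB a b : p a -> p b -> p (a - b).
  by move=> pa pb; apply: filterS (filterI pa pb) => i [/= ai bi]; rewrite /= -[LHS]/(a i - b i) ai bi subrr.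
have pM a b : p b -> p (a * b).
  by apply: filterS => i /= bi; rewrite -[LHS]/(a i * b i) bi mulr0.
have pd j a : p a -> p (delta j a).
  by apply: filterS => i /= ai; rewrite -[LHS]/(delta j (a i)) ai delta0.
have p1 : ~ p 1.
  move=> /filter_ex[i /= /eqP]; rewrite -[X in X == _]/(1 : K i); by rewrite oner_eq0.
have pP a b : p (a * b) -> p a \/ p b.
  move=> pab; have [|na] := in_ultra_setVsetC [set i | a i = 0] UU; first by left.
  right; apply: filterS (filterI pab na) => i [/= /eqP].
  by rewrite -[X in X == _]/(a i * b i) mulf_eq0 => /orP[/eqP//|/eqP].
have p0 : p 0 by apply: filterS filterT => i.
have [L [f fP]] := residue_fieldT p0 pB pM pd p1 pP.
by exists i0, L, f.
Qed.

Section PrimeIdeals.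
Variables (m : nat) (S : diffRingType m).

Record radical_dideal (J : set S) : Prop := {
  rdi0 : J 0;
  rdiB : forall x y, J x -> J y -> J (x - y);
  rdiM : forall x y, J y -> J (x * y);
  rdi_delta : forall i x, J x -> J (delta i x);
  rdi_radical : forall x, J (x * x) -> J x;
  rdi_proper : ~ J 1
}.

Hypothesis natS : forall n, exists u : S, u * n.+1%:R = 1.

(** If x^n = 0, then x^(n-k) delta(x)^(2k) = 0 by induction on k: differentiate, multiply by
    delta(x) and divide by the integer n-k, which is a unit by [natS]. At k = n this makes delta(x)
    nilpotent. *)
Lemma nilradical_dideal : radical_dideal [set x | exists n, x ^+ n = 0].
Proof.
split=> /=.
- by exists 1%N.
- move=> x y [k xk] [l yl]; exists (k + l)%N; rewrite exprBn big1 // => i _.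
  have [ki|ik] := leqP k (k + l - i).
    by rewrite -(subnK ki) exprD xk !mulr0 !mul0r mul0rn.
  have li : (l <= i)%N.
    rewrite leqNgt; apply/negP => il.
    by move: ik; rewrite ltnNge -addnBA ?leq_addr // ltnW.
  by rewrite -(subnK li) [y ^+ _]exprD yl !mulr0 mul0rn.
- by move=> x y [n yn]; exists n; rewrite exprMn yn mulr0.
- move=> i x [n xn].
  have step k : (k <= n)%N -> x ^+ (n - k) * delta i x ^+ (k.*2) = 0.
    elim: k => [|k IH] kn; first by rewrite subn0 expr0 mulr1.
    have {}IH := IH (ltnW kn); have [u nu] := natS (n - k.+1).
    have nk : (n - k = (n - k.+1).+1)%N by rewrite -subSn.
    rewrite nk in IH; set l := (n - k.+1)%N in nu IH *.
    have := congr1 (fun z => delta i z * delta i x) IH.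
    rewrite deltaM delta0 mul0r deltaX mulrDl.
    (* The other Leibniz term dies: differentiating the power of delta(x) lowers its exponent by
       one, and the extra factor delta(x) restores it, so the induction hypothesis applies. *)
    have -> : x ^+ l.+1 * delta i (delta i x ^+ k.*2) * delta i x = 0.
      case: (k.*2) IH => [|j] IH; first by rewrite expr0 delta1 mulr0 mul0r.
      rewrite deltaX mulrnAr mulrnAl mulrA mulrAC -[_ * _ * delta i x]mulrA.
      by rewrite -exprSr IH mul0r mul0rn.
    rewrite addr0 => h; rewrite doubleS !exprSr !mulrA -[LHS]mul1r -nu.
    rewrite -[RHS](mulr0 u) -[in RHS]h -!mulrA; congr (u * _).
    by rewrite -mulr_natl mulrA; ring.
  exists (n.*2); have := step n (leqnn _); by rewrite subnn expr0 mul1r.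
- by move=> x [n xn]; exists (n.*2); rewrite -addnn exprD -exprMn.
- by case=> n /eqP; rewrite expr1n oner_eq0.
Qed.

(** A maximal proper radical Delta-ideal W is prime: if x is not in W, then the colon ideal of x is
    again a proper radical Delta-ideal containing W, hence equals W. The nilradical only provides a
    starting point for Zorn. *)
Lemma dfield_of_dring : exists (L : diffFieldType m) (f : S -> L), dhom_on setT f.
Proof.
have [|W [Wr _ Wmax]] := zorn_above nilradical_dideal.
  move=> C [X0 CX0] Cr totC; split.
  - by exists X0 => //; exact: rdi0 (Cr _ CX0).
  - move=> x y [X CX Xx] [Y CY Yy]; case: (totC _ _ CX CY) => [XY|YX].
      by exists Y => //; apply: (rdiB (Cr _ CY)) => //; exact: XY.
    by exists X => //; apply: (rdiB (Cr _ CX)) => //; exact: YX.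
  - by move=> x y [X CX Xy]; exists X => //; exact: (rdiM (Cr _ CX)).
  - by move=> i x [X CX Xx]; exists X => //; exact: (rdi_delta (Cr _ CX)).
  - by move=> x [X CX Xx]; exists X => //; exact: (rdi_radical (Cr _ CX)).
  - by move=> [X CX X1]; exact: (rdi_proper (Cr _ CX)).
have WM x y : W x -> W (x * y) by move=> Wx; rewrite mulrC; exact: (rdiM Wr).
have Wprime x y : W (x * y) -> W x \/ W y.
  move=> Wxy; have [|nWx] := pselect (W x); first by left.
  right; apply: (Wmax [set s | W (s * x)]); last 2 first.
  - by move=> s; exact: WM.
  - by rewrite /= mulrC.
  split=> /=.
  - by rewrite mul0r; exact: rdi0 Wr.
  - by move=> s t; rewrite mulrBl; exact: (rdiB Wr).
  - by move=> s t; rewrite -mulrA; exact: (rdiM Wr).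
  (* Multiply delta(s x) = delta(s) x + s delta(x) by delta(s) x. The second summand becomes a
     multiple of s x, so the square of delta(s) x is in W, and W is radical. *)
  - move=> i s Wsx; apply: (rdi_radical Wr).
    have := rdi_delta Wr i Wsx; rewrite deltaM => Wd.
    have := rdiB Wr (WM _ (delta i s * x) Wd) (WM _ (delta i x * delta i s) Wsx).
    by congr W; ring.
  - move=> s Wssx; apply: (rdi_radical Wr).
    by have := WM _ x Wssx; congr W; ring.
  - by rewrite mul1r.
have [L [f [fT _]]] := residue_fieldT (rdi0 Wr) (rdiB Wr) (rdiM Wr) (rdi_delta Wr)
  (rdi_proper Wr) Wprime.
by exists L, f.
Qed.

End PrimeIdeals.

(** * Existentially closed extensions *)

Record dsystem (m : nat) (C : Type) := DSystem {
  dsys_arity : nat;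
  dsys_eqs : seq (dterm m C 'I_dsys_arity);
  dsys_neqs : seq (dterm m C 'I_dsys_arity)
}.

Definition solves (m : nat) (C : Type) (S : diffRingType m) (phi : C -> S) (s : dsystem m C)
    (x : 'I_(dsys_arity s) -> S) : Prop :=
  (forall t, List.In t (dsys_eqs s) -> teval phi x t = 0) /\
  (forall t, List.In t (dsys_neqs s) -> teval phi x t <> 0).

Arguments solves {m C S}.

Definition solvable (m : nat) (C : Type) (S : diffRingType m) (phi : C -> S)
    (s : dsystem m C) : Prop := exists x, solves phi s x.

Lemma solvable_dhom (m : nat) (C : Type) (K L : diffFieldType m) (phi : C -> K) (f : K -> L) s :
  dhom_on setT f -> solvable phi s -> solvable (f \o phi) s.
Proof.
move=> fT [x [xe xn]]; exists (f \o x); split=> t ts; rewrite -(teval_dhom t fT) //.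
  by rewrite xe ?(dhom0 fT).
by rewrite -(dhom0 fT) => /(dhom_inj fT); exact: xn.
Qed.

Section Compactness.
Variables (m : nat) (K : diffFieldType m).

Definition consistent (E : set (dsystem m K)) : Prop :=
  forall e : seq (dsystem m K), (forall s, List.In s e -> E s) ->
  exists (L : diffFieldType m) (phi : K -> L),
    dhom_on setT phi /\ forall s, List.In s e -> solvable phi s.

(** Compactness by an ultraproduct: the index set consists of the finite lists from [E], each with
    an extension solving its members. Every single system is solved at almost all indices. *)
Lemma consistent_solvable (E : set (dsystem m K)) : consistent E ->
  exists (L : diffFieldType m) (phi : K -> L),
    dhom_on setT phi /\ forall s, E s -> solvable phi s.
Proof.
move=> cE; pose I := {e : seq (dsystem m K) | forall s, List.In s e -> E s}.
have /choice[M MP] : forall e : I, exists M : {L : diffFieldType m & K -> L},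
    dhom_on setT (projT2 M) /\ forall s, List.In s (sval e) -> solvable (projT2 M) s.
  by move=> [e eE] /=; have [L [phi phiP]] := cE e eE; exists (existT _ L phi).
(* The filter generated by the cones above each finite list; concatenation makes it directed. *)
pose G : set_system I :=
  [set A | exists e0 : I, forall e : I, List.incl (sval e0) (sval e) -> A e].
have catE (e1 e2 : I) : exists e : I, List.incl (sval e1) (sval e) /\ List.incl (sval e2) (sval e).
  case: e1 e2 => [e1 e1E] [e2 e2E].
  have eE s : List.In s (e1 ++ e2) -> E s by move=> h; case: (List.in_app_or _ _ _ h) => [/e1E|/e2E].
  exists (exist _ (e1 ++ e2) eE) => /=.
  by split=> s se; apply: List.in_or_app; [left|right].
have GF : ProperFilter G.
  split; first by move=> [e0 h]; exact: h e0 (@List.incl_refl _ _).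
  split=> [|A B [e1 A1] [e2 B2]|A B AB [e A1]].
  - have eE s : List.In s [::] -> E s by [].
    by exists (exist _ [::] eE).
  - have [e [i1 i2]] := catE e1 e2; exists e => e' ie'.
    by split; [apply: A1; exact: List.incl_tran ie'|apply: B2; exact: List.incl_tran ie'].
  - by exists e => e' /A1 /AB.
have [U [UU GU]] := ultraFilterLemma GF.
have [i0 [L [f [fT fU]]]] := @ultraproduct m I (fun e => projT1 (M e)) U UU.
pose phi (c : K) : dprod (fun e => projT1 (M e)) i0 := fun e => projT2 (M e) c.
have phiT : dhom_on setT phi.
  by apply: dprod_dhom => e; case: (MP e).
exists L, (f \o phi); split; first exact: (dhom_comp phiT fT).
move=> s Es.
have UD : U [set e | List.In s (sval e)].
  apply: GU; have eE s' : List.In s' [:: s] -> E s' by case=> [<-|[]].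
  by exists (exist _ [:: s] eE) => e /(_ s); apply; left.
(* Where [s] is not listed the chosen tuple is 0; such indices form a [U]-small set. *)
have hx : forall e : I, exists x : 'I_(dsys_arity s) -> projT1 (M e),
    List.In s (sval e) -> solves (projT2 (M e)) s x.
  move=> e; have [se|] := pselect (List.In s (sval e)); last by exists (fun=> 0).
  by have [_ /(_ s se)[x]] := MP e; exists x.
pose x e := projT1 (cid (hx e)); have xP e := projT2 (cid (hx e)).
pose X j : dprod (fun e => projT1 (M e)) i0 := fun e => x e j.
exists (f \o X); split=> t ts; rewrite -(teval_dhom t fT) // fU.
  apply: filterS UD => e se /=; rewrite teval_dprod.
  by have [xe _] := xP e se; exact: xe.
move=> Ut; have [e [/= se]] := filter_ex (filterI UD Ut).
by rewrite teval_dprod; have [_ xn] := xP e se; exact: xn.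
Qed.

(* A system solvable over an extension of L can be added to a maximal consistent set. *)
Lemma ec_step : exists (L : diffFieldType m) (phi : K -> L), dhom_on setT phi /\
  forall s (M : diffFieldType m) (psi : L -> M), dhom_on setT psi ->
    solvable (psi \o phi) s -> solvable phi s.
Proof.
have [||E [cE _ maxE]] := @zorn_above _ consistent set0.
- move=> [_|s e /(_ s)[]]; last by left.
  by exists K, idfun; split=> //; exact: dhom_idfun.
- move=> C [X0 CX0] Cc totC e eC.
  have [X CX eX] : exists2 X, C X & forall s, List.In s e -> X s.
    elim: e eC => [|s e IH] eC; first by exists X0.
    have [|X CX eX] := IH; first by move=> s' s'e; apply: eC; right.
    have [Y CY Ys] := eC s (or_introl erefl).
    case: (totC _ _ CX CY) => [XY|YX].
      by exists Y => // s' [<-//|/eX]; exact: XY.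
    by exists X => // s' [<-|/eX//]; exact: YX.
  exact: Cc eX.
have [L [phi [phiT phiE]]] := consistent_solvable cE.
exists L, phi; split=> // s M psi psiT ss; apply: (phiE).
apply: (maxE (E `|` [set s])); [|by left|by right].
move=> e eE; exists M, (psi \o phi); split; first exact: dhom_comp phiT psiT _.
move=> s' /eE[/phiE|-> //].
exact: solvable_dhom.
Qed.

End Compactness.

(** Shifting the whole family in the induction on [j] avoids transport between the types [K_ i]. The
    entries below [j] are arbitrary, taken from the given default elements. *)
Lemma coherent_stream (K_ : nat -> Type) (nu : forall k, K_ k -> K_ k.+1) :
  (forall k, K_ k) -> forall j (c : K_ j),
  exists2 a : forall i, K_ i, a j = c & forall i, (j <= i)%N -> a i.+1 = nu i (a i).
Proof.
move=> z j; elim: j K_ nu z => [|j IH] K_ nu z c.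
  by exists (nat_rect K_ c nu).
have [a ac anu] := IH (fun k => K_ k.+1) (fun k => nu k.+1) (fun k => z k.+1) c.
exists (fun i => match i return K_ i with 0%N => z 0%N | k.+1 => a k end) => //.
by case=> // i; exact: anu.
Qed.

Section DirectLimit.
Variables (m : nat) (K_ : nat -> diffFieldType m) (nu : forall k, K_ k -> K_ k.+1).
Hypothesis nuT : forall k, dhom_on setT (@nu k).
Local Notation prodK := (dprod (fun k => K_ k) 0%N).

Definition coherent_from (N : nat) (a : prodK) : Prop :=
  forall i, (N <= i)%N -> a i.+1 = nu (a i).

Lemma coherent_fromW N N' a : (N <= N')%N -> coherent_from N a -> coherent_from N' a.
Proof. by move=> NN' ca i /(leq_trans NN')/ca. Qed.

Lemma coherent_eq N (a b : prodK) : coherent_from N a -> coherent_from N b ->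
  a N = b N -> forall i, (N <= i)%N -> a i = b i.
Proof.
move=> ca cb ab i; elim: i => [|i IH]; first by rewrite leqn0 => /eqP <-.
rewrite leq_eqVlt => /orP[/eqP <- //|Ni].
by rewrite ca ?cb // IH.
Qed.

Lemma coherent_dhom N : dhom_on (coherent_from N) (@idfun prodK).
Proof.
split=> // [i _|x y cx cy i Ni|x y cx cy i Ni|j x cx i Ni].
- by rewrite -[LHS]/(1 : K_ i.+1) -[x in nu x]/(1 : K_ i) (dhom1 (nuT i)).
- by rewrite -[LHS]/(x i.+1 - y i.+1) -[z in nu z]/(x i - y i) (dhomB (nuT i)) // cx ?cy.
- by rewrite -[LHS]/(x i.+1 * y i.+1) -[z in nu z]/(x i * y i) (dhomM (nuT i)) // cx ?cy.
- by rewrite -[LHS]/(delta j (x i.+1)) -[z in nu z]/(delta j (x i)) (dhom_delta (nuT i)) // cx.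
Qed.

Let A : set prodK := [set a | exists N, coherent_from N a].
Let p : set prodK := [set a | exists N, forall i, (N <= i)%N -> a i = 0].

Let pair_coh (a b : prodK) : A a -> A b -> exists N, coherent_from N a /\ coherent_from N b.
Proof.
move=> [N ca] [N' cb]; exists (maxn N N').
by split; [apply: coherent_fromW ca|apply: coherent_fromW cb]; rewrite leq_max leqnn ?orbT.
Qed.

(** The limit is the ring of eventually coherent sequences modulo the eventually zero ones. A
    coherent sequence that vanishes at one late index vanishes from there on, so primality is tested
    in a single field [K_ N]; fractions are likewise formed at a single stage. *)
Lemma direct_limit : exists (L : diffFieldType m) (emb : forall j, K_ j -> L),
  [/\ forall j, dhom_on setT (@emb j), forall j c, emb j.+1 (nu c) = emb j c
    & forall l, exists j c, l = emb j c].
Proof.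
have A1 : A 1 by exists 0%N; exact: dhom_dom1 (coherent_dhom 0).
have AB x y : A x -> A y -> A (x - y).
  by move=> Ax Ay; have [N [cx cy]] := pair_coh Ax Ay; exists N; exact: (dhom_domB (coherent_dhom N)).
have AM x y : A x -> A y -> A (x * y).
  by move=> Ax Ay; have [N [cx cy]] := pair_coh Ax Ay; exists N; exact: (dhom_domM (coherent_dhom N)).
have Ad i x : A x -> A (delta i x).
  by move=> [N cx]; exists N; exact: (dhom_dom_delta (coherent_dhom N)).
have coh0 N a : coherent_from N a -> a N = 0 -> p a.
  move=> ca aN; exists N => i Ni.
  by rewrite (coherent_eq ca (dhom_dom0 (coherent_dhom N)) aN Ni).
have pA : p `<=` A.
  move=> x [N xN]; exists N => i Ni; rewrite !xN // ?(dhom0 (nuT i)) //.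
  exact: leq_trans Ni _.
have p0 : p 0 by exists 0%N.
have pB x y : p x -> p y -> p (x - y).
  move=> [N xN] [N' yN]; exists (maxn N N') => i; rewrite geq_max => /andP[Ni Ni'].
  by rewrite -[LHS]/(x i - y i) xN // yN // subrr.
have pM x y : A x -> p y -> p (x * y).
  by move=> _ [N yN]; exists N => i Ni; rewrite -[LHS]/(x i * y i) yN // mulr0.
have pd i x : p x -> p (delta i x).
  by move=> [N xN]; exists N => k Nk; rewrite -[LHS]/(delta i (x k)) xN // delta0.
have p1 : ~ p 1.
  by move=> [N /(_ N (leqnn _)) /eqP]; rewrite -[X in X == _]/(1 : K_ N) oner_eq0.
have pP x y : A x -> A y -> p (x * y) -> p x \/ p y.
  move=> Ax Ay [N1 xy]; have [N2 [cx cy]] := pair_coh Ax Ay.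
  pose N := maxn N1 N2; have N1N : (N1 <= N)%N by rewrite leq_maxl.
  have N2N : (N2 <= N)%N by rewrite leq_maxr.
  have := xy N N1N; rewrite -[LHS]/(x N * y N) => /eqP; rewrite mulf_eq0.
  case/orP => /eqP h; [left|right]; apply: (@coh0 N) => //; exact: coherent_fromW N2N _.
have [L [f [fA fp fsurj]]] := residue_field (DPrime A1 AB AM Ad pA p0 pB pM pd p1 pP).
rewrite /= in fA fp fsurj.
have feq N a b : coherent_from N a -> coherent_from N b -> a N = b N -> f a = f b.
  move=> ca cb ab; apply/eqP; rewrite -subr_eq0 -(dhomB fA); [|by exists N..].
  apply/eqP/fp; first by apply: AB; exists N.
  apply: (coh0 N); first exact: (dhom_domB (coherent_dhom N)).
  by rewrite -[LHS]/(a N - b N) ab subrr.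
pose st j (c : K_ j) : prodK := sval (cid2 (coherent_stream nu (fun k => 0) c)).
have stc j (c : K_ j) : coherent_from j (st j c) by rewrite /st; case: cid2.
have stE j (c : K_ j) : st j c j = c by rewrite /st; case: cid2.
exists L, (fun j c => f (st j c)); split=> [j|j c|l].
- apply: dhom_onT => [|x y|x y|i x] /=.
  + rewrite -(dhom1 fA); apply: (feq j); rewrite ?stE //; exact: dhom_dom1 (coherent_dhom j).
  + rewrite -(dhomD fA); [|by exists j..].
    apply: (feq j) => //; first exact: (dhom_domD (coherent_dhom j)).
    by rewrite -[RHS]/(st j x j + st j y j) !stE.
  + rewrite -(dhomM fA); [|by exists j..].
    apply: (feq j) => //; first exact: (dhom_domM (coherent_dhom j)).
    by rewrite -[RHS]/(st j x j * st j y j) !stE.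
  + rewrite -(dhom_delta fA); last by exists j.
    apply: (feq j) => //; first exact: (dhom_dom_delta (coherent_dhom j)).
    by rewrite -[RHS]/(delta i (st j x j)) !stE.
- apply: (feq j.+1) => //; first exact: coherent_fromW (stc j c).
  by rewrite stE stc // stE.
- have [a [b [Aa Ab pb ->]]] := fsurj l.
  have [N [ca cb]] := pair_coh Aa Ab.
  have bN : b N != 0 by apply: contra_notN pb => /eqP; exact: coh0.
  have fb : f b != 0 by apply/eqP => /(fp _ Ab).
  exists N, (a N / b N); apply: (mulIf fb); rewrite divfK //.
  rewrite -(dhomM fA) //; last by exists N.
  apply: (feq N) => //; first exact: (dhom_domM (coherent_dhom N)).
  by rewrite -[RHS]/(st N (a N / b N) N * b N) stE divfK.
Qed.

End DirectLimit.

Section Closure.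
Variable m : nat.

Definition ec_next (K : diffFieldType m) : {L : diffFieldType m & K -> L} :=
  let h := cid (ec_step K) in existT _ (projT1 h) (projT1 (cid (projT2 h))).

Lemma ec_nextP (K : diffFieldType m) : dhom_on setT (projT2 (ec_next K)) /\
  forall s (M : diffFieldType m) (psi : projT1 (ec_next K) -> M), dhom_on setT psi ->
    solvable (psi \o projT2 (ec_next K)) s -> solvable (projT2 (ec_next K)) s.
Proof. exact: projT2 (cid (projT2 (cid (ec_step K)))). Qed.

Fixpoint ec_chain (K : diffFieldType m) (k : nat) : diffFieldType m :=
  if k is k'.+1 then projT1 (ec_next (ec_chain K k')) else K.

(** A term has finitely many coefficients, so they all come from one stage of the chain. *)
Lemma dterm_lift (L : Type) (I : Type) (K_ : nat -> Type) (emb : forall j, K_ j -> L)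
    (nu : forall j, K_ j -> K_ j.+1) (t : dterm m L I) :
  (forall j c, emb j.+1 (nu j c) = emb j c) -> (forall l, exists j c, l = emb j c) ->
  exists j, forall i, (j <= i)%N -> exists t', tmap (emb i) id t' = t.
Proof.
move=> nuE surj.
have up j (c : K_ j) i : (j <= i)%N -> exists c', emb i c' = emb j c.
  elim: i => [|i IH]; first by rewrite leqn0 => /eqP j0; subst j; exists c.
  rewrite leq_eqVlt => /orP[/eqP ji|ji]; first by subst j; exists c.
  by have [c' <-] := IH ji; exists (nu i c').
elim: t => [l|x|k t [j tj]|t [j tj] u [j' uj]|t [j tj] u [j' uj]].
- have [j [c ->]] := surj l; exists j => i /(up j c)[c' cc'].
  by exists (TC c'); rewrite /= cc'.
- by exists 0%N => i _; exists (TV x).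
- by exists j => i /tj[t' <-]; exists (TD k t').
- exists (maxn j j') => i; rewrite geq_max => /andP[/tj[t' <-] /uj[u' <-]].
  by exists (TA t' u').
- exists (maxn j j') => i; rewrite geq_max => /andP[/tj[t' <-] /uj[u' <-]].
  by exists (TM t' u').
Qed.

Lemma dterms_lift (L : Type) (I : Type) (K_ : nat -> Type) (emb : forall j, K_ j -> L)
    (nu : forall j, K_ j -> K_ j.+1) (ts : seq (dterm m L I)) :
  (forall j c, emb j.+1 (nu j c) = emb j c) -> (forall l, exists j c, l = emb j c) ->
  exists j, forall i, (j <= i)%N -> exists ts', map (tmap (emb i) id) ts' = ts.
Proof.
move=> nuE surj; elim: ts => [|t ts [j tj]]; first by exists 0%N => i _; exists [::].
have [j' tj'] := dterm_lift t nuE surj.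
exists (maxn j j') => i; rewrite geq_max => /andP[/tj[ts' <-] /tj'[t' <-]].
by exists (t' :: ts').
Qed.

(** [ec_step] handles only systems with coefficients in the given field, so it is iterated and the
    limit taken. A finite system over the limit has its coefficients at some stage j; if it is
    solvable in an extension of the limit, then, as this also extends stage j+1, it is already
    solvable at stage j+1. *)
Lemma exists_DCF0 (K : diffFieldType m) : [pchar K] =i pred0 ->
  exists (L : diffFieldType m) (phi : K -> L), DCF0 L /\ dhom_on setT phi.
Proof.
move=> K0; pose K_ := ec_chain K.
pose nu k : K_ k -> K_ k.+1 := projT2 (ec_next (K_ k)).
have nuT k : dhom_on setT (nu k) by case: (ec_nextP (K_ k)).
have [L [emb [embT embnu surj]]] := direct_limit nuT.
exists L, (emb 0%N); split; last exact: (embT 0%N).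
split; first exact: pchar0_dhom (embT 0%N) K0.
move=> n eqs neqs M phi phid [x [xe xn]].
have phiT := dhom_rmorphism phid.
have [j1 h1] := dterms_lift (map (@term_of_dpoly m L 'I_n) eqs) embnu surj.
have [j2 h2] := dterms_lift (map (@term_of_dpoly m L 'I_n) neqs) embnu surj.
pose j := maxn j1 j2; have [eqs' eqsE] := h1 j (leq_maxl _ _).
have [neqs' neqsE] := h2 j (leq_maxr _ _).
have mem_In y (ps : seq (dpoly L 'I_n)) : List.In y (map (@term_of_dpoly m L 'I_n) ps) ->
    exists2 q, q \in ps & term_of_dpoly q = y.
  elim: ps => //= q ps IH [<-|/IH[q' q'ps <-]]; first by exists q; rewrite ?mem_head.
  by exists q' => //; rewrite inE q'ps orbT.
have memE (ps : seq (dpoly L 'I_n)) q : q \in ps ->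
    List.In (term_of_dpoly q) (map (@term_of_dpoly m L 'I_n) ps).
  elim: ps => //= q' ps IH; rewrite inE => /orP[/eqP ->|/IH]; first by left.
  by right.
pose s := DSystem eqs' neqs'.
have phijT : dhom_on setT (phi \o emb j.+1) by exact: dhom_comp (embT _) phiT _.
have [_ /(_ s M (phi \o emb j.+1) phijT)] := ec_nextP (K_ j).
have evE (S : diffRingType m) (psi : L -> S) y t :
    teval (psi \o emb j.+1 \o nu j) y t = teval psi y (tmap (emb j) id t).
  by rewrite teval_tmap; apply: eq_teval => // c /=; rewrite embnu.
case.
  exists x; split=> t ts; rewrite [LHS]evE.
    have : List.In (tmap (emb j) id t) (map (@term_of_dpoly m L 'I_n) eqs).
      by rewrite -eqsE; exact: List.in_map.
    by case/mem_In => q qe <-; rewrite -deval_term // xe.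
  have : List.In (tmap (emb j) id t) (map (@term_of_dpoly m L 'I_n) neqs).
    by rewrite -neqsE; exact: List.in_map.
  by case/mem_In => q qe <-; rewrite -deval_term //; exact: xn.
move=> y [/= ye yn]; exists (emb j.+1 \o y).
have idT := dhom_idfun L.
have devE q t : tmap (emb j) id t = term_of_dpoly q ->
    deval idfun (emb j.+1 \o y) q = emb j.+1 (teval (nu j) y t).
  move=> tq; rewrite (deval_term _ idT) -tq -evE.
  by rewrite (teval_dhom _ (embT j.+1)).
split=> q /memE; rewrite -?eqsE -?neqsE => tin; have [t tts tq] := In_map tin; rewrite (devE _ _ tq).
  by rewrite ye // (dhom0 (embT _)).
by rewrite -(dhom0 (embT j.+1)) => /(dhom_inj (embT j.+1)); exact: yn.
Qed.

End Closure.

(** * Finite specialization of points *)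

Inductive fterm (C V : Type) : Type :=
| FC of C
| FV of V
| FA of fterm C V & fterm C V
| FM of fterm C V & fterm C V.
Arguments FC {C V}. Arguments FV {C V}. Arguments FA {C V}. Arguments FM {C V}.

Section FlatTerms.
Variables (m : nat) (F : diffFieldType m) (V : Type) (sh : 'I_m -> V -> V).
Local Notation term := (fterm F V).
Implicit Types (t c : term) (cs ds : seq term) (Q : V -> Prop).

Fixpoint feval (S : diffRingType m) (phi : F -> S) (w : V -> S) t : S :=
  match t with
  | FC c => phi c
  | FV v => w v
  | FA t u => feval phi w t + feval phi w u
  | FM t u => feval phi w t * feval phi w u
  end.

Fixpoint fuses Q t : Prop :=
  match t with
  | FC _ => True
  | FV v => Q v
  | FA t u => fuses Q t /\ fuses Q u
  | FM t u => fuses Q t /\ fuses Q u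
  end.

(** Flat terms are ordinary polynomials whose variables stand for derivatives of the point, which
    makes leading variables and pseudo-division available. The derivation becomes this syntactic
    operation, acting on variables through [sh]. *)
Fixpoint fD j t : term :=
  match t with
  | FC c => FC (delta j c)
  | FV v => FV (sh j v)
  | FA t u => FA (fD j t) (fD j u)
  | FM t u => FA (FM (fD j t) u) (FM t (fD j u))
  end.

Lemma fuses_imp Q Q' t : (forall v, Q v -> Q' v) -> fuses Q t -> fuses Q' t.
Proof.
by move=> QQ'; elim: t => //= [t IHt u IHu [/IHt ? /IHu]|t IHt u IHu [/IHt ? /IHu]].
Qed.

Lemma fuses_fD j Q Q' t : (forall v, Q v -> Q' v /\ Q' (sh j v)) ->
  fuses Q t -> fuses Q' (fD j t).
Proof.
move=> QQ'; elim: t => //= [v /QQ' []//|t IHt u IHu [/IHt ? /IHu//]|t IHt u IHu [Qt Qu]].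
have QQ v : Q v -> Q' v by case/QQ'.
by split; split; [exact: IHt|exact: fuses_imp Qu|exact: fuses_imp Qt|exact: IHu].
Qed.

Definition luses Q cs : Prop := foldr (fun c P => fuses Q c /\ P) True cs.

(** Horner form of the polynomial in [v] with coefficient list [cs], constant coefficient first; a
    list of size k+1 thus has formal degree k. *)
Definition lterm v cs : term := foldr (fun c acc => FA c (FM (FV v) acc)) (FC 0) cs.

Fixpoint ladd cs ds : seq term :=
  match cs, ds with
  | [::], _ => ds
  | _, [::] => cs
  | c :: cs, d :: ds => FA c d :: ladd cs ds
  end.

Definition lscale c ds : seq term := map (FM c) ds.

Fixpoint lmul cs ds : seq term :=
  if cs is c :: cs then ladd (lscale c ds) (FC 0 :: lmul cs ds) else [::].

Fixpoint lderk k cs : seq term :=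
  if cs is c :: cs then FM (FC k%:R) c :: lderk k.+1 cs else [::].

Definition lder cs : seq term := lderk 1 (behead cs).

Lemma luses_cat Q cs ds : luses Q (cs ++ ds) <-> luses Q cs /\ luses Q ds.
Proof. by elim: cs => [|c cs IH] /=; [tauto|rewrite IH; tauto]. Qed.

Lemma luses_rcons Q cs c : luses Q (rcons cs c) <-> luses Q cs /\ fuses Q c.
Proof. by rewrite -cats1 luses_cat /=; tauto. Qed.

Lemma luses_map Q (f : term -> term) cs :
  (forall c, fuses Q c -> fuses Q (f c)) -> luses Q cs -> luses Q (map f cs).
Proof. by move=> Qf; elim: cs => //= c cs IH [/Qf ? /IH]. Qed.

Lemma luses_lscale Q c ds : fuses Q c -> luses Q ds -> luses Q (lscale c ds).
Proof. by move=> Qc; apply: luses_map. Qed.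

Lemma luses_ladd Q cs ds : luses Q cs -> luses Q ds -> luses Q (ladd cs ds).
Proof. by elim: cs ds => [|c cs IH] [|d ds] //= [? /IH h] [? /h]. Qed.

Lemma luses_lmul Q cs ds : luses Q cs -> luses Q ds -> luses Q (lmul cs ds).
Proof.
elim: cs => //= c cs IH [Qc Qcs] Qds; apply: luses_ladd; first exact: luses_lscale.
by split=> //; exact: IH.
Qed.

Lemma luses_lderk Q k cs : luses Q cs -> luses Q (lderk k cs).
Proof. by elim: cs k => //= c cs IH k [? /IH]. Qed.

Lemma luses_lder Q cs : luses Q cs -> luses Q (lder cs).
Proof. by case: cs => //= c cs [_]; exact: luses_lderk. Qed.

Lemma fuses_lterm Q v cs : Q v -> luses Q cs -> fuses Q (lterm v cs).
Proof. by move=> Qv; elim: cs => //= c cs IH [? /IH]. Qed.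

Lemma luses_imp Q Q' cs : (forall v, Q v -> Q' v) -> luses Q cs -> luses Q' cs.
Proof. by move=> QQ'; elim: cs => //= c cs IH [/(fuses_imp QQ') ? /IH]. Qed.

Lemma luses_fD j Q Q' cs : (forall v, Q v -> Q' v /\ Q' (sh j v)) ->
  luses Q cs -> luses Q' (map (fD j) cs).
Proof. by move=> QQ'; elim: cs => //= c cs IH [/(fuses_fD QQ') ? /IH]. Qed.

Lemma size_ladd cs ds : size (ladd cs ds) = maxn (size cs) (size ds).
Proof. by elim: cs ds => [|c cs IH] [|d ds] //=; rewrite ?max0n ?maxn0 // IH maxnSS. Qed.

Lemma size_lderk k cs : size (lderk k cs) = size cs.
Proof. by elim: cs k => //= c cs IH k; rewrite IH. Qed.

Lemma lderk_rcons k cs c :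
  lderk k (rcons cs c) = rcons (lderk k cs) (FM (FC (k + size cs)%:R) c).
Proof. by elim: cs k => [|d cs IH] k /=; rewrite ?addn0 // IH addSnnS. Qed.

Section Value.
Variables (S : diffRingType m) (phi : F -> S) (w : V -> S).
Hypothesis phiT : dhom_on setT phi.

Definition lev v cs : S := feval phi w (lterm v cs).

Lemma lev_nil v : lev v [::] = 0.
Proof. exact: dhom0 phiT. Qed.

Lemma lev_cons v c cs : lev v (c :: cs) = feval phi w c + w v * lev v cs.
Proof. by []. Qed.

Lemma lev_cat v cs ds : lev v (cs ++ ds) = lev v cs + w v ^+ size cs * lev v ds.
Proof.
elim: cs => [|c cs IH] /=; first by rewrite lev_nil add0r mul1r.
by rewrite !lev_cons IH exprS; ring.
Qed.

Lemma lev_rcons v cs c : lev v (rcons cs c) = lev v cs + w v ^+ size cs * feval phi w c.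
Proof. by rewrite -cats1 lev_cat lev_cons lev_nil mulr0 addr0. Qed.

Lemma lev_ladd v cs ds : lev v (ladd cs ds) = lev v cs + lev v ds.
Proof.
elim: cs ds => [|c cs IH] [|d ds] //=; rewrite ?lev_nil ?addr0 ?add0r //.
by rewrite !lev_cons /= IH; ring.
Qed.

Lemma lev_lscale v c ds : lev v (lscale c ds) = feval phi w c * lev v ds.
Proof.
elim: ds => [|d ds IH]; first by rewrite lev_nil mulr0.
by rewrite [lscale _ _]/= !lev_cons IH /=; ring.
Qed.

Lemma lev_lmul v cs ds : lev v (lmul cs ds) = lev v cs * lev v ds.
Proof.
elim: cs => [|c cs IH] /=; first by rewrite lev_nil mul0r.
by rewrite lev_ladd lev_lscale !lev_cons IH /= (dhom0 phiT); ring.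
Qed.

Lemma lev_nseq0 v k : lev v (nseq k (FC 0)) = 0.
Proof.
by elim: k => [|k IH]; rewrite ?lev_nil //= lev_cons IH /= (dhom0 phiT) mulr0 addr0.
Qed.

Lemma lev_lderkS v k cs : lev v (lderk k.+1 cs) = lev v (lderk k cs) + lev v cs.
Proof.
elim: cs k => [|c cs IH] k /=; first by rewrite !lev_nil addr0.
by rewrite !lev_cons IH /= !(dhom_natr _ phiT) mulrSr; ring.
Qed.

Hypothesis wsh : forall j v, delta j (w v) = w (sh j v).

Lemma feval_fD j t : feval phi w (fD j t) = delta j (feval phi w t).
Proof.
elim: t => //= [c|t -> u ->|t -> u ->]; first exact: (dhom_delta phiT).
  by rewrite deltaD.
by rewrite deltaM.
Qed.

(** The chain rule: a derived relation is linear in the new derivative, with the separant as its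
    coefficient. *)
Lemma delta_lev j v cs :
  delta j (lev v cs) = lev v (map (fD j) cs) + lev v (lder cs) * w (sh j v).
Proof.
elim: cs => [|c cs IH]; first by rewrite !lev_nil delta0 mul0r addr0.
rewrite [map _ _]/= -[lder (c :: cs)]/(lderk 1 cs) !lev_cons deltaD deltaM IH feval_fD lev_lderkS wsh.
(* The weights 0, 1, 2, ... describe the operator v d/dv; its constant coefficient vanishes, so [v]
   factors out. *)
have -> : lev v (lderk 0 cs) = w v * lev v (lder cs).
  by case: cs {IH} => [|d ds]; rewrite /= ?lev_nil ?mulr0 // lev_cons /= (dhom0 phiT) mul0r add0r.
by ring.
Qed.

End Value.

Lemma lterm_expand (Q : V -> Prop) v t : fuses (fun u => u = v \/ Q u) t ->
  exists2 cs, luses Q cs & forall (S : diffRingType m) (phi : F -> S) w,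
    dhom_on setT phi -> feval phi w t = lev phi w v cs.
Proof.
elim: t => [c|u|t IHt u IHu|t IHt u IHu] /=.
- move=> _; exists [:: FC c] => // S phi w phiT.
  by rewrite lev_cons lev_nil // mulr0 addr0.
- case=> [->|Qu].
    exists [:: FC 0; FC 1] => // S phi w phiT.
    by rewrite !lev_cons lev_nil //= (dhom0 phiT) (dhom1 phiT); ring.
  exists [:: FV u] => // S phi w phiT.
  by rewrite lev_cons lev_nil // mulr0 addr0.
- move=> [/IHt[cs Qcs tE] /IHu[ds Qds uE]].
  exists (ladd cs ds); first exact: luses_ladd.
  by move=> S phi w phiT; rewrite lev_ladd // tE // uE.
- move=> [/IHt[cs Qcs tE] /IHu[ds Qds uE]].
  exists (lmul cs ds); first exact: luses_lmul.
  by move=> S phi w phiT; rewrite lev_lmul // tE // uE.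
Qed.

Inductive above (e : V) : V -> Prop :=
| above_refl : above e e
| above_sh j v : above e v -> above e (sh j v).

Record point (S : diffRingType m) (phi : F -> S) (w : V -> S) : Prop := {
  point_dhom : dhom_on setT phi;
  point_sh : forall j v, delta j (w v) = w (sh j v)
}.

Variable lt : V -> V -> Prop.
Hypothesis lt_trans : forall u v w, lt u v -> lt v w -> lt u w.
Hypothesis lt_total : forall u v, [\/ lt u v, u = v | lt v u].
Hypothesis lt_wf : well_founded lt.
Hypothesis sh_lt : forall j v, lt v (sh j v).
Hypothesis sh_mono : forall j u v, lt u v -> lt (sh j u) (sh j v).
Hypothesis dickson : forall E : set V, exists2 l : seq V,
  forall e, List.In e l -> E e & forall v, E v -> exists2 e, List.In e l & above e v.
Hypothesis F0 : [pchar F] =i pred0.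

Local Notation below v := (lt^~ v).

Lemma shift_linear e M v : luses (below e) M -> above e v -> v = e \/
  exists T, [/\ fuses (below v) T, fuses (below v) (lterm e (lder M)) &
    forall (S : diffRingType m) (phi : F -> S) w, point phi w -> lev phi w e M = 0 ->
      feval phi w T + lev phi w e (lder M) * w v = 0].
Proof.
move=> eM; elim=> [|j {}v _ IH]; first by left.
right; case: IH => [->|[T [uT uS TS]]].
  exists (lterm e (map (fD j) M)); split.
  - apply: fuses_lterm (sh_lt j e) _; apply: luses_fD eM => u ue.
    by split; [exact: lt_trans ue (sh_lt j e)|exact: sh_mono].
  - apply: fuses_lterm (sh_lt j e) _; apply: luses_imp (luses_lder eM) => u ue.
    exact: lt_trans ue (sh_lt j e).
  - move=> S phi w [phiT wsh] M0.
    by rewrite -[feval _ _ _]/(lev phi w e _) -delta_lev // M0 delta0.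
have upv u : lt u v -> lt u (sh j v) /\ lt (sh j u) (sh j v).
  by move=> uv; split; [exact: lt_trans uv (sh_lt j v)|exact: sh_mono].
(* Differentiating T + S v = 0 gives (delta T + (delta S) v) + S delta(v) = 0; the bracket is the
   new [T]. *)
exists (FA (fD j T) (FM (fD j (lterm e (lder M))) (FV v))); split=> /=.
- split; first exact: fuses_fD uT.
  by split; [exact: fuses_fD uS|exact: sh_lt].
- by apply: fuses_imp uS => u /upv[].
- move=> S phi w pw M0; have [phiT wsh] := pw.
  have := congr1 (delta j) (TS _ _ _ pw M0).
  by rewrite !feval_fD // deltaD deltaM delta0 wsh addrA.
Qed.

Lemma fterm_closed t : fuses (fun=> False) t ->
  exists c : F, forall (S : diffRingType m) (phi : F -> S) w,
    dhom_on setT phi -> feval phi w t = phi c.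
Proof.
elim: t => //= [c _|t IHt u IHu [/IHt[c tc] /IHu[d ud]]|t IHt u IHu [/IHt[c tc] /IHu[d ud]]].
- by exists c.
- by exists (c + d) => S phi w phiT; rewrite tc // ud // (dhomD phiT).
- by exists (c * d) => S phi w phiT; rewrite tc // ud // (dhomM phiT).
Qed.

Lemma fterm_leader Q t : fuses Q t ->
  fuses (fun=> False) t \/ exists2 v, Q v & fuses (fun u => u = v \/ lt u v) t.
Proof.
have max2 (t1 t2 : term) :
    (fuses (fun=> False) t1 \/ exists2 v, Q v & fuses (fun u => u = v \/ lt u v) t1) ->
    (fuses (fun=> False) t2 \/ exists2 v, Q v & fuses (fun u => u = v \/ lt u v) t2) ->
    (fuses (fun=> False) t1 /\ fuses (fun=> False) t2) \/ exists2 v, Q v &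
      fuses (fun u => u = v \/ lt u v) t1 /\ fuses (fun u => u = v \/ lt u v) t2.
  move=> [c1|[v1 Q1 u1]] [c2|[v2 Q2 u2]]; first by left.
  - by right; exists v2 => //; split=> //; exact: fuses_imp c1.
  - by right; exists v1 => //; split=> //; exact: fuses_imp c2.
  right; case: (lt_total v1 v2) => v12.
  - exists v2 => //; split=> //; apply: fuses_imp u1 => u [->|uv]; right=> //.
    exact: lt_trans v12.
  - by subst v2; exists v1.
  - exists v1 => //; split=> //; apply: fuses_imp u2 => u [->|uv]; right=> //.
    exact: lt_trans v12.
elim: t => [c _|v Qv|t1 IH1 t2 IH2 [/IH1 h1 /IH2 h2]|t1 IH1 t2 IH2 [/IH1 h1 /IH2 h2]].
- by left.
- by right; exists v => //; left.
- exact: max2.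
- exact: max2.
Qed.

(** Its negation makes a relation [lev phi w v cs = 0] a nontrivial algebraic equation for [w v]
    over the lower derivatives. *)
Definition lzero (S : diffRingType m) (phi : F -> S) w cs : Prop :=
  foldr (fun c P => feval phi w c = 0 /\ P) True cs.

Lemma lzero_rcons (S : diffRingType m) (phi : F -> S) w cs c :
  lzero phi w (rcons cs c) <-> lzero phi w cs /\ feval phi w c = 0.
Proof. by elim: cs => [|d cs IH] /=; [tauto|rewrite IH; tauto]. Qed.

Lemma lzero_lev (S : diffRingType m) (phi : F -> S) w v cs :
  dhom_on setT phi -> lzero phi w cs -> lev phi w v cs = 0.
Proof.
move=> phiT; elim: cs => [|c cs IH /= [c0 /IH cs0]]; first by rewrite lev_nil.
by rewrite lev_cons c0 cs0 mulr0 addr0.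
Qed.

Section GenericPoint.
Variables (L : diffFieldType m) (phi : F -> L) (w : V -> L).
Hypothesis pw : point phi w.
Let phiT := point_dhom pw.

Definition algebraic_over_below : set V := [set v |
  exists cs, [/\ luses (below v) cs, lev phi w v cs = 0 & ~ lzero phi w cs]].

Record minimal_poly v M0 I : Prop := {
  mp_uses : luses (below v) (rcons M0 I);
  mp_lev : lev phi w v (rcons M0 I) = 0;
  mp_init : feval phi w I <> 0;
  mp_sep : lev phi w v (lder (rcons M0 I)) <> 0;
  mp_min : forall cs, luses (below v) cs -> (size cs <= size M0)%N ->
    lev phi w v cs = 0 -> lzero phi w cs
}.

(** Take a nontrivial relation of least length. A vanishing leading coefficient could be dropped,
    leaving a shorter one; a vanishing separant would itself be a shorter relation. *)
Lemma minimal_poly_exists v : algebraic_over_below v -> exists M0 I, minimal_poly v M0 I.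
Proof.
move=> Ev; pose R k := `[< exists cs, [/\ size cs = k, luses (below v) cs,
  lev phi w v cs = 0 & ~ lzero phi w cs] >].
have exR : exists k, R k by have [cs [? ? ?]] := Ev; exists (size cs); apply/asboolP; exists cs.
case: (ex_minnP exR) => k /asboolP[M [sM uM lM zM]] kmin.
have minM cs : luses (below v) cs -> (size cs < k)%N -> lev phi w v cs = 0 -> lzero phi w cs.
  move=> ucs csk lcs; apply: contrapT => zcs; move: csk; rewrite ltnNge => /negP; apply.
  by apply: kmin; apply/asboolP; exists cs.
case/lastP: M sM uM lM zM => [//|M0 I]; rewrite size_rcons => sM uM lM zM; subst k.
have I0 : feval phi w I <> 0.
  move=> I0; apply: zM; apply/lzero_rcons; split=> //; apply: minM => //.
    by move/luses_rcons: uM => [].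
  by move: lM; rewrite lev_rcons // I0 mulr0 addr0.
exists M0, I; split=> //; case: M0 {kmin} uM lM zM minM => [|c M0] uM lM zM minM.
  by move: lM; rewrite lev_cons lev_nil // mulr0 addr0.
rewrite [rcons _ _]/= /lder [behead _]/= => l0.
(* By minimality all coefficients of the separant would vanish; the top one is the degree times [I],
   which is nonzero in characteristic 0. *)
have /lzero_rcons[_ /= /eqP] : lzero phi w (rcons (lderk 1 M0) (FM (FC (1 + size M0)%:R) I)).
  rewrite -lderk_rcons; apply: minM => //; last by rewrite size_lderk size_rcons.
  by apply: luses_lderk; case: uM.
rewrite (dhom_natr _ phiT) mulf_eq0 => /orP[|/eqP//].
by rewrite add1n; apply/negP/pchar0_natr_neq0; exact: pchar0_dhom phiT F0.
Qed.

Section Specialization.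
Variables (B : diffFieldType m) (psi : F -> B) (w' : V -> B).
Hypothesis pw' : point psi w'.
Let psiT := point_dhom pw'.

(** Multiplying by the initial [I] and subtracting a multiple of the divisor shortens a relation
    without changing its truth at either point, and [I] can be cancelled because it does not vanish
    at [w']. The hypothesis on short lists treats the remainder. *)
Lemma pseudo_division v M0 I :
  luses (below v) (rcons M0 I) -> lev phi w v (rcons M0 I) = 0 ->
  lev psi w' v (rcons M0 I) = 0 -> feval psi w' I <> 0 ->
  (forall cs, luses (below v) cs -> (size cs <= size M0)%N ->
     lev phi w v cs = 0 -> lev psi w' v cs = 0) ->
  forall cs, luses (below v) cs -> lev phi w v cs = 0 -> lev psi w' v cs = 0.
Proof.
move=> uM lM lM' I0 small cs; have [k] := ubnP (size cs); elim: k cs => // k IH cs.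
rewrite ltnS => csk ucs lcs; have [csM|] := leqP (size cs) (size M0); first exact: small.
case/lastP: cs csk ucs lcs => [//|cs c]; rewrite size_rcons !ltnS => csk ucs lcs M0cs.
have [uM0 uI] : luses (below v) M0 /\ fuses (below v) I by apply/luses_rcons.
have [uc ucs'] : fuses (below v) c /\ luses (below v) cs by case/luses_rcons: ucs.
pose j := (size cs - size M0)%N.
(* I cs - c v^j M0, where both leading terms are left out beforehand because they cancel. *)
pose cs' := ladd (lscale I cs) (lscale (FC (-1)) (nseq j (FC 0) ++ lscale c M0)).
have lE (S : diffRingType m) (chi : F -> S) (x : V -> S) : dhom_on setT chi ->
    lev chi x v cs' = feval chi x I * lev chi x v (rcons cs c)
      - feval chi x c * x v ^+ j * lev chi x v (rcons M0 I).
  move=> chiT; rewrite lev_ladd // !lev_lscale // lev_cat // lev_lscale // lev_nseq0 //.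
  rewrite !lev_rcons // size_nseq /= (dhomN chiT) // (dhom1 chiT) -{1}(subnK M0cs) -/j exprD.
  by ring.
have := lE _ _ w' psiT; rewrite lM' mulr0 subr0 IH.
- by move/esym/eqP; rewrite mulf_eq0 => /orP[/eqP//|/eqP].
- rewrite /cs' size_ladd !size_map size_cat size_nseq size_map subnK // maxnn.
  exact: leq_trans csk.
- apply: luses_ladd; first exact: luses_lscale.
  apply: luses_lscale => //; apply/luses_cat; split; last exact: luses_lscale.
  by elim: (j) => //= ? ?; split.
- by rewrite lE // lcs lM !mulr0 subr0.
Qed.

Variable basis : seq V.
Hypothesis basisP : forall v, algebraic_over_below v ->
  exists2 e, List.In e basis & above e v.
Hypothesis basis_spec : forall e, List.In e basis -> exists M0 I, minimal_poly e M0 I /\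
  [/\ lev psi w' e (rcons M0 I) = 0, feval psi w' I <> 0
     & lev psi w' e (lder (rcons M0 I)) <> 0].

Lemma specialize_closed t : fuses (fun=> False) t ->
  feval phi w t = 0 -> feval psi w' t = 0.
Proof.
move=> /fterm_closed[c tc]; rewrite !tc // -(dhom0 phiT) => /(dhom_inj phiT) ->.
exact: dhom0 psiT.
Qed.

(** Well-founded induction on the leader [u]. If [u] is not algebraic over lower derivatives, every
    coefficient vanishes and has smaller rank. If [u] is a basis element, divide by its minimal
    polynomial; if it is a proper derivative of one, divide by the linear equation of
    [shift_linear]. *)
Lemma specialize_le u t : fuses (fun x => x = u \/ lt x u) t ->
  feval phi w t = 0 -> feval psi w' t = 0.
Proof.
elim/(well_founded_ind lt_wf): u t => u IH0 t /lterm_expand[cs ucs tE]; rewrite !tE //.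
have IH d : fuses (below u) d -> feval phi w d = 0 -> feval psi w' d = 0.
  by move=> /fterm_leader[/specialize_closed//|[x xu ud]]; exact: IH0 ud.
have lz ds : luses (below u) ds -> lzero phi w ds -> lzero psi w' ds.
  by elim: ds => //= d ds IHd [ud /IHd uds] [d0 /uds]; split=> //; exact: IH.
have [Eu|nEu] := pselect (algebraic_over_below u); last first.
  move=> lcs; apply: lzero_lev => //; apply: lz => //.
  by apply: contrapT => zcs; apply: nEu; exists cs.
have [e /basis_spec[M0 [I [mp [lM' I' S']]]] eu] := basisP Eu.
have uM := mp_uses mp; have [ue|[T [uT uS TS]]] := shift_linear uM eu.
  subst u; apply: (pseudo_division uM (mp_lev mp) lM' I') => // ds uds dsM lds.
  by apply: lzero_lev => //; apply: lz => //; exact: (mp_min mp) lds.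
(* The divisor has degree 1 in [u], with the separant as initial, so remainders are single terms of
   lower rank. *)
apply: (@pseudo_division u [:: T] (lterm e (lder (rcons M0 I)))) => //.
- rewrite /= lev_cons /= -[RHS](TS _ _ _ pw (mp_lev mp)) lev_cons lev_nil //.
  by rewrite mulr0 addr0 mulrC.
- rewrite /= lev_cons /= -[RHS](TS _ _ _ pw' lM') lev_cons lev_nil //.
  by rewrite mulr0 addr0 mulrC.
- case=> [|c [|//]]; first by rewrite !lev_nil.
  by rewrite !lev_cons !lev_nil // !mulr0 !addr0 => -[uc _] _; exact: IH.
Qed.

Lemma specialize t : feval phi w t = 0 -> feval psi w' t = 0.
Proof.
have [||[v _]] := @fterm_leader (fun=> True) t.
- by elim: t => //= *; split.
- exact: specialize_closed.
- exact: specialize_le.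
Qed.

End Specialization.

Lemma finite_specialization : exists eqs neqs : seq term,
  [/\ forall t, List.In t eqs -> feval phi w t = 0,
      forall t, List.In t neqs -> feval phi w t <> 0 &
      forall (B : diffFieldType m) (psi : F -> B) (w' : V -> B), point psi w' ->
        (forall t, List.In t eqs -> feval psi w' t = 0) ->
        (forall t, List.In t neqs -> feval psi w' t <> 0) ->
        forall t, feval phi w t = 0 -> feval psi w' t = 0].
Proof.
have [l lE lP] := dickson algebraic_over_below.
suff [eqs [neqs [ze zn spec]]] : exists eqs neqs : seq term,
  [/\ forall t, List.In t eqs -> feval phi w t = 0,
      forall t, List.In t neqs -> feval phi w t <> 0 &
      forall (B : diffFieldType m) (psi : F -> B) (w' : V -> B),
        (forall t, List.In t eqs -> feval psi w' t = 0) ->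
        (forall t, List.In t neqs -> feval psi w' t <> 0) ->
        forall e, List.In e l -> exists M0 I, minimal_poly e M0 I /\
          [/\ lev psi w' e (rcons M0 I) = 0, feval psi w' I <> 0
            & lev psi w' e (lder (rcons M0 I)) <> 0]].
  exists eqs, neqs; split=> // B psi w' pw' ze' zn'.
  exact: (specialize pw' lP) (spec _ _ _ ze' zn').
elim: l lE {lP} => [|e l IH] lE; first by exists [::], [::].
have [|eqs [neqs [ze zn spec]]] := IH; first by move=> e' e'l; apply: lE; right.
have [M0 [I mp]] := minimal_poly_exists (lE e (or_introl erefl)).
exists (lterm e (rcons M0 I) :: eqs), (I :: lterm e (lder (rcons M0 I)) :: neqs); split.
- by move=> t [<-|/ze//]; exact: mp_lev mp.
- by move=> t [<-|[<-|/zn//]]; [exact: mp_init mp|exact: mp_sep mp].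
move=> B psi w' ze' zn' e' [<-|e'l]; last first.
  by apply: spec e'l => t tI; [apply: ze'; right|apply: zn'; right; right].
exists M0, I; split=> //; split.
- by apply: ze'; left.
- by apply: zn'; left.
- by apply: zn'; right; left.
Qed.

End GenericPoint.

End FlatTerms.

(** * A ranking of the derivatives and the Dickson lemma *)

Fixpoint slt (s t : seq nat) : bool :=
  match s, t with
  | x :: s', y :: t' => (x < y)%N || ((x == y) && slt s' t')
  | _, _ => false
  end.

Lemma slt_trans s t u : slt s t -> slt t u -> slt s u.
Proof.
elim: s t u => [|x s IH] [|y t] [|z u] //= /orP[xy|/andP[/eqP -> st]] /orP[yz|/andP[/eqP <- tu]].
- by rewrite (ltn_trans xy yz).
- by rewrite xy.
- by rewrite yz.
- by rewrite eqxx (IH _ _ st tu) orbT.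
Qed.

Lemma slt_total s t : size s = size t -> [\/ slt s t, s = t | slt t s].
Proof.
elim: s t => [|x s IH] [|y t] //= => [_|[/IH st]]; first by constructor 2.
case: (ltngtP x y) => [xy|yx|<-] /=.
- by constructor 1.
- by constructor 3.
by case: st => [st|->|ts]; [constructor 1|constructor 2|constructor 3].
Qed.

(** Equal length matters: [1], [0;1], [0;0;1], ... descends forever. At fixed length the proof nests
    inductions on the length, on the head and on the accessibility of the tail. *)
Lemma slt_acc s : Acc (fun a b => size a = size b /\ slt a b) s.
Proof.
move e : (size s) => k; elim: k s e => [|k IHk] s e.
  by apply: Acc_intro => t [_]; rewrite (size0nil e); case: t.
case: s e => [//|x s] /= /succn_inj sk.
move: sk; elim/ltn_ind: x s => x IHx s sk; have acc_s := IHk s sk; elim: acc_s sk => {}s _ IHs sk.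
apply: Acc_intro => -[[]//|y t [/succn_inj ts]] /= /orP[yx|/andP[/eqP -> lt_ts]].
  by apply: IHx => //; exact: etrans ts sk.
by apply: IHs; [split|exact: etrans ts sk].
Qed.

(** Choose a finite basis of the tails, lift it with some heads, and let K bound these heads.
    Members with head at least K lie above a lifted one; each of the finitely many slices with a
    smaller head has a finite basis by induction. *)
Lemma dickson_seq n (E : set (seq nat)) : (forall s, E s -> size s = n) ->
  exists2 l : seq (seq nat), forall s, List.In s l -> E s &
    forall t, E t -> exists2 s, List.In s l & all2 leq s t.
Proof.
elim: n E => [|n IH] E En.
  have [E0|nE0] := pselect (E [::]).
    exists [:: [::]]; first by move=> s [<-|[]].
    by move=> t /[dup] /En /size0nil -> _; exists [::] => //; left.
  by exists [::] => // t /[dup] /En /size0nil ->.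
have [l0 l0T l0P] := IH [set s | exists k, E (k :: s)] (fun s '(ex_intro k h) => succn_inj (En _ h)).
have [l1 [K [l1E l1P]]] : exists l1 K, (forall u, List.In u l1 -> E u) /\
    forall s, List.In s l0 -> exists2 k, List.In (k :: s) l1 & (k <= K)%N.
  elim: l0 l0T {l0P} => [|s l0 IHl] l0T; first by exists [::], 0%N.
  have [|l1 [K [l1E l1P]]] := IHl; first by move=> u ul; apply: l0T; right.
  have [k Ek] := l0T s (or_introl erefl).
  exists ((k :: s) :: l1), (maxn k K); split; first by move=> u [<-|/l1E].
  move=> u [<-|/l1P[k' k'l k'K]]; first by exists k; [left|exact: leq_maxl].
  by exists k'; [right|rewrite leq_max k'K orbT].
have [l2 l2E l2P] : exists2 l2, forall u, List.In u l2 -> E u &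
    forall h s, (h < K)%N -> E (h :: s) -> exists2 u, List.In u l2 & all2 leq u (h :: s).
  elim: K {l1P} => [|K [l2 l2E l2P]]; first by exists [::].
  have [l3 l3E l3P] := IH [set s | E (K :: s)] (fun s h => succn_inj (En _ h)).
  exists (map (cons K) l3 ++ l2).
    move=> u /In_cat[ul|/l2E//].
    by have [s sl3 <-] := In_map ul; exact: (l3E s).
  move=> h s; rewrite ltnS leq_eqVlt => /orP[/eqP -> /l3P[u ul us]|hK /(l2P _ _ hK)[u ul us]].
    exists (K :: u); last by rewrite /= leqnn.
    by apply/In_cat; left; exact: List.in_map.
  by exists u => //; apply/In_cat; right.
exists (l1 ++ l2); first by move=> u /In_cat[/l1E|/l2E].
move=> [/En//|k s] Eks; have [kK|Kk] := ltnP k K.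
  by have [u ul us] := l2P _ _ kK Eks; exists u => //; apply/In_cat; right.
have [|s' /l1P[k' k'l k'K] s's] := l0P s; first by exists k.
exists (k' :: s'); first by apply/In_cat; left.
by rewrite /= (leq_trans k'K Kk).
Qed.

Definition dshift (m : nat) (I : Type) (j : 'I_m) (v : I * {ffun 'I_m -> nat}) :=
  (v.1, shift_ffun v.2 j).

Section Derivatives.
Variables (m n : nat).
Local Notation V := ('I_n * {ffun 'I_m -> nat})%type.

(** An elimination ranking: first the indeterminate, then the exponents lexicographically. All keys
    have length m+1, as well-foundedness requires. *)
Definition dkey (v : V) : seq nat := (v.1 : nat) :: [seq v.2 j | j <- enum 'I_m].
Definition dlt (u v : V) : Prop := slt (dkey u) (dkey v).

Lemma size_dkey v : size (dkey v) = m.+1.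
Proof. by rewrite /= size_map size_enum_ord. Qed.

Lemma dkey_inj : injective dkey.
Proof.
move=> [i a] [k b] [/= /val_inj -> /eq_in_map ab]; congr (_, _).
by apply/ffunP => j; apply: ab; rewrite mem_enum.
Qed.

Lemma dlt_trans u v w : dlt u v -> dlt v w -> dlt u w.
Proof. exact: slt_trans. Qed.

Lemma dlt_total u v : [\/ dlt u v, u = v | dlt v u].
Proof.
have [|?|/dkey_inj ?|?] := @slt_total (dkey u) (dkey v); first by rewrite !size_dkey.
- by constructor 1.
- by constructor 2.
- by constructor 3.
Qed.

Lemma dlt_wf : well_founded dlt.
Proof.
move=> v; move e : (dkey v) => s; elim: (slt_acc s) v e => {}s _ IH v e.
by constructor=> u uv; apply: (IH (dkey u)) => //; rewrite -e !size_dkey.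
Qed.

Lemma dshift_lt j v : dlt v (dshift j v).
Proof.
rewrite /dlt /= ltnn eqxx /=; have := mem_enum 'I_m j; rewrite inE.
elim: (enum _) => //= k s IH; rewrite inE ffunE => /orP[/eqP ->|/IH h].
  by rewrite eqxx addn1 ltnSn.
by case: (k == j); rewrite ?addn1 ?ltnSn // addn0 eqxx h orbT.
Qed.

Lemma dshift_mono j u v : dlt u v -> dlt (dshift j u) (dshift j v).
Proof.
rewrite /dlt /= => /orP[-> //|/andP[-> uv]]; rewrite orbC /=; apply/orP; left.
elim: (enum _) uv => //= k s IH; rewrite !ffunE ltn_add2r eqn_add2r.
by case/orP => [->//|/andP[-> /IH ->]]; rewrite orbT.
Qed.

Lemma above_leq i (a b : {ffun 'I_m -> nat}) :
  (forall j, (a j <= b j)%N) -> above (@dshift m 'I_n) (i, a) (i, b).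
Proof.
move=> ab; have [k] := ubnP (\sum_j (b j - a j))%N; elim: k b ab => // k IH b ab.
rewrite ltnS => sk; have [/existsP[j abj]|] := boolP [exists j, (a j < b j)%N]; last first.
  rewrite negb_exists => /forallP ba; suff -> : b = a by constructor.
  by apply/ffunP => j; apply/eqP; rewrite eqn_leq ab leqNgt ba.
pose b' := [ffun l => (b l - (l == j))%N].
have bj0 : (0 < b j)%N by exact: leq_ltn_trans abj.
have -> : (i, b) = dshift j (i, b').
  rewrite /dshift /=; congr (_, _); apply/ffunP => l; rewrite !ffunE.
  by case: eqVneq => [->|_]; rewrite ?subn0 ?addn0 // subnK.
constructor; apply: IH => [l|].
  by rewrite ffunE; case: eqVneq => [->|_]; rewrite ?subn0 // leq_subRL // add1n.
apply: leq_trans sk; rewrite (bigD1 j) //= [X in (_ < X)%N](bigD1 j) //=.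
rewrite -addSn leq_add //; last first.
  by apply: leq_sum => l /negPf lj; rewrite ffunE lj subn0.
by rewrite ffunE eqxx -subSn ?subn1 ?prednK // -ltnS prednK.
Qed.

Lemma dickson_derivatives (E : set V) : exists2 l : seq V,
  forall e, List.In e l -> E e & forall v, E v -> exists2 e, List.In e l & above (@dshift m 'I_n) e v.
Proof.
suff [l lE lP] : exists2 l : seq V, forall e, List.In e l -> E e &
    forall v, v.1 \in enum 'I_n -> E v -> exists2 e, List.In e l & above (@dshift m 'I_n) e v.
  by exists l => // v; apply: lP; rewrite mem_enum.
elim: (enum _) => [|i s [l lE lP]]; first by exists [::].
pose Ei : set (seq nat) := [set [seq v.2 j | j <- enum 'I_m] | v in [set v : V | v.1 = i /\ E v]].
have [l1 l1E l1P] : exists2 l : seq (seq nat), forall s, List.In s l -> Ei s &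
    forall t, Ei t -> exists2 s, List.In s l & all2 leq s t.
  by apply: (@dickson_seq m) => _ [v _ <-]; rewrite size_map size_enum_ord.
have [l2 l2E l2P] : exists2 l2 : seq V, forall e, List.In e l2 -> E e &
    forall t, List.In t l1 -> exists2 e, List.In e l2 & e.1 = i /\ [seq e.2 j | j <- enum 'I_m] = t.
  elim: l1 l1E {l1P} => [|t l1 IH] l1E; first by exists [::].
  have [|l2 l2E l2P] := IH; first by move=> u ul; apply: l1E; right.
  have [e [ei Ee] et] := l1E t (or_introl erefl).
  exists (e :: l2); first by move=> u [<-|/l2E].
  move=> u [<-|/l2P[e' e'l e'P]]; first by exists e => //; left.
  by exists e' => //; right.
exists (l2 ++ l); first by move=> u /In_cat[/l2E|/lE].
move=> v; rewrite inE => /orP[/eqP vi|vs] Ev; last first.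
  by have [e el ev] := lP v vs Ev; exists e => //; apply/In_cat; right.
have [|t /l2P[e el [ei et]] tv] := l1P [seq v.2 j | j <- enum 'I_m]; first by exists v.
exists e; first by apply/In_cat; left.
case: e ei et {el} => i' a /= -> et; case: v vi tv {Ev} => i'' b /= -> tv.
apply: above_leq => j; move: tv; rewrite -et; have := mem_enum 'I_m j; rewrite inE.
elim: (enum _) => //= k s' IH; rewrite inE => /orP[/eqP ->|js'] /andP[//].
by move=> _; exact: IH.
Qed.

End Derivatives.

(** * Translations between Delta-terms, flat terms and Delta-polynomials *)

Section FlatPolynomials.
Variables (m : nat) (F : diffFieldType m) (I : choiceType).
Local Notation V := (I * {ffun 'I_m -> nat})%type.

Definition derivatives (S : diffRingType m) (x : I -> S) (v : V) : S := theta v.2 (x v.1).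

Section MonomialEval.
Variables (S : diffRingType m) (x : I -> S).

Lemma dmonom_evalEw (d : {fset V}) (u : {cmonom V}) : fsubset (finsupp u) d ->
  dmonom_eval x u = \prod_(v <- enum_fset d) derivatives x v ^+ u v.
Proof.
move=> ud; rewrite /dmonom_eval (big_fset_incl _ ud) // => v _ vu.
by rewrite (_ : u v = 0%N) //; apply/eqP; rewrite cmE_eq0.
Qed.

(** Both factors are evaluated over the union of their supports, where exponents add. This makes
    [mmap] multiplicative. *)
Lemma dmonom_eval_mmorphism : mmorphism (dmonom_eval x).
Proof.
split=> [u v|]; last by rewrite /dmonom_eval mdom1 big_seq_fset0.
rewrite (dmonom_evalEw (d := fsetU (finsupp u) (finsupp v))) ?mdomD //.
rewrite (dmonom_evalEw (fsubsetUl (finsupp u) (finsupp v))).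
rewrite (dmonom_evalEw (fsubsetUr (finsupp u) (finsupp v))) -big_split /=.
by apply: eq_bigr => i _; rewrite cmM exprD.
Qed.

HB.instance Definition _ := monalg.isMultiplicative.Build _ _ (dmonom_eval x)
  dmonom_eval_mmorphism.

End MonomialEval.

Fixpoint dpoly_of_fterm (t : fterm F V) : dpoly F I :=
  match t with
  | FC c => malgC c
  | FV v => mkmalgU (ucm v) 1
  | FA t u => dpoly_of_fterm t + dpoly_of_fterm u
  | FM t u => dpoly_of_fterm t * dpoly_of_fterm u
  end.

Lemma deval_dpoly_of_fterm (S : diffRingType m) (phi : {rmorphism F -> S}) (x : I -> S) t :
  deval phi x (dpoly_of_fterm t) = feval phi (derivatives x) t.
Proof.
elim: t => /= [c|v|t <- u <-|t <- u <-].
- exact: mmapC.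
- transitivity (phi 1 * dmonom_eval x (ucm v)); first exact: mmapU.
  by rewrite rmorph1 mul1r /dmonom_eval mdomU big_seq_fset1 cmUU expr1.
- exact: mmapD.
- exact: (rmorphM (mmap phi (dmonom_eval x))).
Qed.

Fixpoint fterm_of_dterm (t : dterm m F I) : fterm F V :=
  match t with
  | TC c => FC c
  | TV i => FV (i, [ffun=> 0%N])
  | TD j t => fD (@dshift m I) j (fterm_of_dterm t)
  | TA t u => FA (fterm_of_dterm t) (fterm_of_dterm u)
  | TM t u => FM (fterm_of_dterm t) (fterm_of_dterm u)
  end.

Lemma feval_fterm_of_dterm (S : diffRingType m) (phi : F -> S) (x : I -> S) t :
  dhom_on setT phi -> feval phi (derivatives x) (fterm_of_dterm t) = teval phi x t.
Proof.
move=> phiT; elim: t => //= [i|j t IH|t -> u ->|t -> u ->] //.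
  by rewrite /derivatives theta0.
by rewrite feval_fD ?IH // => k v; rewrite /derivatives theta_shift.
Qed.

Definition dpoly_of_dterm t : dpoly F I := dpoly_of_fterm (fterm_of_dterm t).

Lemma deval_dpoly_of_dterm (S : diffRingType m) (phi : {rmorphism F -> S}) (x : I -> S) t :
  dmorphism phi -> deval phi x (dpoly_of_dterm t) = teval phi x t.
Proof.
move=> phid; rewrite deval_dpoly_of_fterm feval_fterm_of_dterm //.
exact: dhom_rmorphism.
Qed.

End FlatPolynomials.

(** Existential closedness covers finite systems only. The finite system determining the Delta-ideal
    of [x], with [h] added to its inequations, is solved by [x] itself, and any F-solution satisfies
    every equation of [x]. *)
Lemma DCF0_specialize_ord (m n : nat) (F L : diffFieldType m) (phi : F -> L) (x : 'I_n -> L)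
    (h : dterm m F 'I_n) :
  DCF0 F -> dhom_on setT phi -> teval phi x h <> 0 ->
  exists2 y : 'I_n -> F, teval idfun y h <> 0 &
    forall t, teval phi x t = 0 -> teval idfun y t = 0.
Proof.
move=> [F0 ecF] phiT hx; have idT := dhom_idfun F.
have pt (S : diffRingType m) (psi : F -> S) (z : 'I_n -> S) : dhom_on setT psi ->
    point (@dshift m 'I_n) psi (derivatives z).
  by move=> psiT; split=> // j v; rewrite /derivatives theta_shift.
have [eqs [neqs [ze zn spec]]] := finite_specialization (@dlt_trans m n) (@dlt_total m n)
  (@dlt_wf m n) (@dshift_lt m n) (@dshift_mono m n) (@dickson_derivatives m n) F0 (pt _ _ x phiT).
have [g gd gE] := rmorphism_of_dhom phiT.
have fE z : feval g (derivatives x) z = feval phi (derivatives x) z.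
  by elim: z => //= [t -> u ->|t -> u ->].
pose to_dpoly := @dpoly_of_fterm m F 'I_n.
have inP z (ts : seq (fterm F ('I_n * {ffun 'I_m -> nat})%type)) :
    z \in map to_dpoly ts -> exists2 t, List.In t ts & to_dpoly t = z.
  elim: ts => //= t ts IH; rewrite inE => /orP[/eqP ->|/IH[t' t'ts <-]].
    by exists t => //; left.
  by exists t' => //; right.
have Pin t (ts : seq (fterm F ('I_n * {ffun 'I_m -> nat})%type)) :
    List.In t ts -> to_dpoly t \in map to_dpoly ts.
  by elim: ts => //= t' ts IH [->|/IH ts']; rewrite inE ?eqxx // ts' orbT.
have [] := ecF n (map to_dpoly eqs) (map to_dpoly (fterm_of_dterm h :: neqs)) L g gd.
  exists x; split=> p /inP[t ts <-]; rewrite deval_dpoly_of_fterm fE; first exact: ze.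
  by case: ts => [<-|/zn//]; rewrite feval_fterm_of_dterm.
move=> y [ye yn]; have dE t : deval idfun y (to_dpoly t) = feval idfun (derivatives y) t.
  exact: (deval_dpoly_of_fterm (idfun : {rmorphism F -> F})).
exists y.
  rewrite -feval_fterm_of_dterm // -dE; apply: yn; apply: Pin; by left.
move=> t; rewrite -!feval_fterm_of_dterm //; apply: spec; first exact: pt.
  by move=> u /Pin /ye; rewrite dE.
by move=> u un; rewrite -dE; apply: yn; apply: Pin; right.
Qed.

(* A Delta-generic point over F of any (possibly infinite) system specializes to an F-point:
   this replaces the basis theorem for radical differential ideals. *)
Lemma DCF0_specialize (m : nat) (J : finType) (F L : diffFieldType m) (phi : F -> L)
    (x : J -> L) (h : dterm m F J) :
  DCF0 F -> dhom_on setT phi -> teval phi x h <> 0 ->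
  exists2 y : J -> F, teval idfun y h <> 0 &
    forall t, teval phi x t = 0 -> teval idfun y t = 0.
Proof.
move=> FC phiT hx.
have reix (S : diffRingType m) (psi : F -> S) (z : J -> S) t :
    teval psi (z \o @enum_val J predT) (tmap id (@enum_rank J) t) = teval psi z t.
  by rewrite teval_tmap; apply: eq_teval => // i /=; rewrite enum_rankK.
have [|y yh yt] := @DCF0_specialize_ord m #|J| F L phi (x \o @enum_val J predT)
  (tmap id (@enum_rank J) h) FC phiT; first by rewrite reix.
exists (y \o @enum_rank J); first by move: yh; rewrite teval_tmap.
by move=> t; rewrite -reix => /yt; rewrite teval_tmap.
Qed.

(** * Extension of homomorphisms to R{x} *)

Section Adjunction.
Variables (m : nat) (F K L : diffFieldType m) (J : Type).
Variables (phi : F -> K) (x : J -> K) (R : set K) (f : K -> L).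
Hypothesis phiT : dhom_on setT phi.
Hypothesis fR : dhom_on R f.
Hypothesis Rlocal : forall r, R r -> f r <> 0 -> R r^-1.
Hypothesis L0 : [pchar L] =i pred0.

Local Notation term := (dterm m F J).
Local Notation ev := (teval phi x).

(** Finite sums of elements of [A] times values at [x] of Delta-terms over F. With [A] the kernel of
    [f] this is the Delta-ideal m R{x} of the overview. *)
Inductive dspan (A : set K) : set K :=
| dspan0 : dspan A 0
| dspanS r t z : A r -> dspan A z -> dspan A (r * ev t + z).

Definition dker : set K := [set r | R r /\ f r = 0].
Definition dker_span : set K := dspan dker.
Local Notation N := dker_span.

Lemma dkerM r k : R r -> dker k -> dker (r * k).
Proof.
by move=> Rr [Rk k0]; split; [exact: (dhom_domM fR)|rewrite (dhomM fR) // k0 mulr0].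
Qed.

Lemma dker_delta i k : dker k -> dker (delta i k).
Proof.
by move=> [Rk k0]; split; [exact: (dhom_dom_delta fR)|rewrite (dhom_delta fR) // k0 delta0].
Qed.

Lemma dkerD k k' : dker k -> dker k' -> dker (k + k').
Proof.
by move=> [Rk k0] [Rk' k0']; split; [exact: (dhom_domD fR)|rewrite (dhomD fR) // k0 k0' addr0].
Qed.

Lemma NR r z : R r -> N z -> N (r * z).
Proof.
move=> Rr; elim=> [|k t {}z Rk _ IH]; first by rewrite mulr0; exact: dspan0.
by rewrite mulrDr mulrA; apply: dspanS => //; exact: dkerM.
Qed.

Lemma ND y z : N y -> N z -> N (y + z).
Proof. by move=> + Nz; elim=> [|k t {}y Rk _ IH]; rewrite ?add0r // -addrA; apply: dspanS. Qed.

Lemma NN z : N z -> N (- z).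
Proof.
rewrite -mulN1r; apply: NR; apply: (dhom_domN fR); exact: dhom_dom1 fR.
Qed.

Lemma NB y z : N y -> N z -> N (y - z).
Proof. by move=> Ny /NN; exact: ND. Qed.

Lemma Nev t z : N z -> N (ev t * z).
Proof.
elim=> [|k u {}z Rk _ IH]; first by rewrite mulr0; exact: dspan0.
rewrite mulrDr (_ : ev t * (k * ev u) = k * ev (TM t u)); last by rewrite /=; ring.
exact: dspanS.
Qed.

Lemma Nker k : dker k -> N k.
Proof.
move=> kk; have := @dspanS dker k (TC 1) 0 kk (dspan0 _).
by rewrite /= (dhom1 phiT) mulr1 addr0.
Qed.

Lemma Ndelta i z : N z -> N (delta i z).
Proof.
elim=> [|k u {}z Rk _ IH]; first by rewrite delta0; exact: dspan0.
rewrite deltaD deltaM -addrA; apply: dspanS; first exact: dker_delta.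
by rewrite -[delta i (ev u)]/(ev (TD i u)); apply: dspanS.
Qed.

(* Lifts to R of the linear functionals of L over the residue field of R. *)
Record functional (g : L -> K) : Prop := {
  fun_dom : forall l, R (g l);
  fun_add : forall l l', dker (g (l + l') - (g l + g l'));
  fun_scale : forall c l, R c -> dker (g (f c * l) - c * g l)
}.

Lemma functionalM g l : functional g -> functional (fun l' => g (l' * l)).
Proof.
move=> gF; split=> [l'|l1 l2|c l' Rc]; first exact: fun_dom gF _.
  by rewrite mulrDl; exact: fun_add gF _ _.
by rewrite -mulrA; exact: (fun_scale gF).
Qed.

(** The commutator of g with the derivation is again linear modulo m. It accounts for the failure of
    g to commute with [delta i] when the derivation of the tensor product is tested. *)
Lemma functional_delta g i : functional g ->
  functional (fun l => delta i (g l) - g (delta i l)).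
Proof.
move=> gF; have gR := fun_dom gF.
have dE a b : a = b -> dker b -> dker a by move=> ->.
split=> [l|l l'|c l Rc].
- by apply: (dhom_domB fR) => //; exact: (dhom_dom_delta fR).
- apply: dE (dkerD (dker_delta i (fun_add gF l l')) (dkerM (dhom_domN fR (dhom_dom1 fR)) (fun_add gF (delta i l) (delta i l')))).
  by rewrite !deltaB !deltaD; ring.
- have h1 := dker_delta i (fun_scale gF l Rc).
  have h2 := fun_scale gF l (dhom_dom_delta fR i Rc).
  have h3 := fun_scale gF (delta i l) Rc.
  have h4 := fun_add gF (f (delta i c) * l) (f c * delta i l).
  have N1 : R (-1) by apply: (dhom_domN fR); exact: dhom_dom1 fR.
  apply: dE (dkerD h1 (dkerM N1 (dkerD h2 (dkerD h3 h4)))).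
  by rewrite !deltaM deltaB deltaM -(dhom_delta fR) //; ring.
Qed.

(** A linear projection of L onto the line of 1 over R/m: H is an R-submodule maximal among those
    avoiding 1, and L = H + f(R). Locality of R supplies the inverses of scalars. *)
Lemma functional_exists : exists2 g, functional g & dker (g 1 - 1).
Proof.
pose P (H : set L) := [/\ H 0, forall a b, H a -> H b -> H (a + b),
  forall c a, R c -> H a -> H (f c * a) & ~ H 1].
have [||H [[H0 HD HM H1] _ maxH]] := @zorn_above L P [set 0].
- split=> // [a b -> ->|c a Rc ->|/eqP]; rewrite ?addr0 ?mulr0 //.
  by rewrite oner_eq0.
- move=> C [X0 CX0] CP totC; split.
  + by exists X0 => //; have [] := CP _ CX0.
  + move=> a b [X CX Xa] [Y CY Yb]; case: (totC _ _ CX CY) => [XY|YX].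
      by exists Y => //; have [_ YD _ _] := CP _ CY; apply: YD => //; exact: XY.
    by exists X => //; have [_ XD _ _] := CP _ CX; apply: XD => //; exact: YX.
  + by move=> c a Rc [X CX Xa]; exists X => //; have [_ _ XM _] := CP _ CX; exact: XM.
  + by move=> [X CX X1]; have [_ _ _] := CP _ CX.
have R0 := dhom_dom0 fR; have R1 := dhom_dom1 fR; have f0 := dhom0 fR; have f1 := dhom1 fR.
have RN1 : R (-1) by exact: (dhom_domN fR).
have HN a : H a -> H (- a).
  by move=> /(HM (-1) _ RN1); rewrite (dhomN fR) // f1 mulN1r.
have Hf c : R c -> H (f c) -> f c = 0.
  move=> Rc Hc; apply: contrapT => fc; apply: H1.
  have := HM _ _ (Rlocal Rc fc) Hc; rewrite -(dhomM fR) //; last exact: Rlocal.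
  rewrite mulVf ?f1 //; apply/eqP => c0; exact: fc (etrans (congr1 f c0) f0).
have ex l : exists c, R c /\ H (l - f c).
  (* H' is H + f(R) l. If it avoids 1, maximality puts l in H and c = 0 works; otherwise 1 = h +
     f(c) l can be solved for l modulo H. *)
  pose H' := [set a | exists h c, [/\ H h, R c & a = h + f c * l]].
  have [[h [c [Hh Rc e1]]]|nH'1] := pselect (H' 1); last first.
    exists 0; split=> //; rewrite f0 subr0; apply: (maxH H').
    - split=> //; first by exists 0, 0; rewrite f0 mul0r addr0.
      + move=> _ _ [h [c [Hh Rc ->]]] [h' [c' [Hh' Rc' ->]]].
        exists (h + h'), (c + c'); split; [exact: HD|exact: (dhom_domD fR)|].
        by rewrite (dhomD fR) //; ring.
      + move=> c _ Rc [h [c' [Hh Rc' ->]]]; exists (f c * h), (c * c').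
        by split; [exact: HM|exact: (dhom_domM fR)|rewrite (dhomM fR) //; ring].
    - by move=> h Hh; exists h, 0; rewrite f0 mul0r addr0.
    - by exists 0, 1; rewrite f1 mul1r add0r.
  have fc : f c <> 0.
    by move=> fc; apply: H1; rewrite e1 fc mul0r addr0.
  have Rc' := Rlocal Rc fc; exists c^-1; split=> //.
  have c0 : c != 0 by apply/eqP => c0; exact: fc (etrans (congr1 f c0) f0).
  have fV : f c^-1 * f c = 1 by rewrite -(dhomM fR) // mulVf.
  have -> : l - f c^-1 = - (f c^-1 * h); last by apply: HN; exact: HM.
  rewrite -[X in X - _]mul1r -fV -[X in _ - X]mulr1 e1; ring.
have [g gP] := choice ex.
have gR l : R (g l) by case: (gP l).
have gH l : H (l - f (g l)) by case: (gP l).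
exists g; first split=> //.
- move=> l l'; have RB : R (g (l + l') - (g l + g l')).
    by apply: (dhom_domB fR) => //; exact: (dhom_domD fR).
  split=> //; apply: Hf => //; rewrite (dhomB fR) ?(dhomD fR) //; last exact: (dhom_domD fR).
  have := HD _ _ (HN _ (gH (l + l'))) (HD _ _ (gH l) (gH l')).
  by congr H; ring.
- move=> c l Rc; have RB : R (g (f c * l) - c * g l).
    by apply: (dhom_domB fR) => //; exact: (dhom_domM fR).
  split=> //; apply: Hf => //; rewrite (dhomB fR) ?(dhomM fR) //; last exact: (dhom_domM fR).
  have := HD _ _ (HN _ (gH (f c * l))) (HM _ _ Rc (gH l)).
  by congr H; ring.
- have RB : R (g 1 - 1) by exact: (dhom_domB fR).
  split=> //; apply: Hf => //; rewrite (dhomB fR) // f1 -opprB; apply: HN; exact: gH.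
Qed.

Definition tensor_pre := {classic seq (term * L)}.
HB.instance Definition _ := Choice.on tensor_pre.

Definition tval (g : L -> K) (s : seq (term * L)) : K := \sum_(p <- s) ev p.1 * g p.2.

(** Functionals of L separate the elements of a tensor product over the field R/m, so formal sums
    are compared through all of them. No bilinear relations or bases are needed, and nontriviality
    follows from one functional with g(1) = 1. *)
Definition tensor_eqv (s s' : tensor_pre) : bool :=
  `[< forall g, functional g -> N (tval g s - tval g s') >].

Lemma tensor_eqv_equiv : equiv_class_of tensor_eqv.
Proof.
split=> [s|s t|s t u].
- by apply/asboolP => g _; rewrite subrr; exact: dspan0.
- by apply: asbool_equiv_eq; split=> h g /h /NN; rewrite opprB.
- move=> /asboolP h1 /asboolP h2; apply/asboolP => g gF.
  by have := ND (h1 g gF) (h2 g gF); congr N; ring.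
Qed.

Canonical tensor_equiv := EquivRelPack tensor_eqv_equiv.

Definition tensor := {eq_quot tensor_equiv}.
HB.instance Definition _ := Choice.on tensor.
HB.instance Definition _ := EqQuotient.on tensor.

Lemma tensorP (s t : tensor_pre) : (\pi_tensor s = \pi_tensor t) <->
  forall g, functional g -> N (tval g s - tval g t).
Proof. by split=> [/eqquotP/asboolP|h] //; apply/eqquotP/asboolP. Qed.

Lemma tensorW (P : tensor -> Prop) : (forall s, P (\pi_tensor s)) -> forall a, P a.
Proof. by move=> Ps a; rewrite -(reprK a). Qed.

Lemma tensor_eq (s t : tensor_pre) : (forall g, tval g s = tval g t) ->
  \pi_tensor s = \pi_tensor t.
Proof. by move=> st; apply/tensorP => g _; rewrite st subrr; exact: dspan0. Qed.

Definition tmul (s t : seq (term * L)) : seq (term * L) :=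
  [seq (TM p.1 q.1, p.2 * q.2) | p <- s, q <- t].
Definition topp (s : seq (term * L)) : seq (term * L) :=
  [seq (TM (TC (-1)) p.1, p.2) | p <- s].
Fixpoint tdelta i (s : seq (term * L)) : seq (term * L) :=
  if s is p :: s then (TD i p.1, p.2) :: (p.1, delta i p.2) :: tdelta i s else [::].

Lemma tval_cat g s t : tval g (s ++ t) = tval g s + tval g t.
Proof. exact: big_cat. Qed.

Lemma tval_cons g p s : tval g (p :: s) = ev p.1 * g p.2 + tval g s.
Proof. exact: big_cons. Qed.

Lemma tval_nil g : tval g [::] = 0.
Proof. exact: big_nil. Qed.

Lemma tval_topp g s : tval g (topp s) = - tval g s.
Proof.
rewrite /tval big_map /= -sumrN; apply: eq_bigr => p _.
by rewrite (dhomN phiT) // (dhom1 phiT); ring.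
Qed.

Lemma tval_tmul g s t : tval g (tmul s t) =
  \sum_(p <- s) \sum_(q <- t) ev p.1 * ev q.1 * g (p.2 * q.2).
Proof. by rewrite /tval big_allpairs_dep. Qed.

(** Testing a product by g amounts to testing its left factor by the functionals g(. l), which is
    how the product is seen to respect the equivalence. *)
Lemma tval_tmulr g s t : tval g (tmul s t) =
  \sum_(q <- t) ev q.1 * tval (fun l => g (l * q.2)) s.
Proof.
rewrite tval_tmul exchange_big; apply: eq_bigr => q _.
by rewrite /tval mulr_sumr; apply: eq_bigr => p _; ring.
Qed.

Lemma tval_tdelta g i s : tval g (tdelta i s) =
  delta i (tval g s) - tval (fun l => delta i (g l) - g (delta i l)) s.
Proof.
elim: s => [|p s IH]; first by rewrite !tval_nil delta0 subr0.
by rewrite [tdelta _ _]/= !tval_cons IH deltaD deltaM /=; ring.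
Qed.

Lemma N_sum (T : Type) (s : seq T) (h : T -> K) : (forall p, N (h p)) -> N (\sum_(p <- s) h p).
Proof.
by move=> hN; elim: s => [|p s IH]; rewrite ?big_nil ?big_cons; [exact: dspan0|exact: ND].
Qed.

Definition tensor_add (a b : tensor) : tensor := \pi_tensor (repr a ++ repr b : tensor_pre).
Definition tensor_mul (a b : tensor) : tensor := \pi_tensor (tmul (repr a) (repr b) : tensor_pre).
Definition tensor_opp (a : tensor) : tensor := \pi_tensor (topp (repr a) : tensor_pre).
Definition tensor_delta i (a : tensor) : tensor := \pi_tensor (tdelta i (repr a) : tensor_pre).

Lemma repr_eqv s g : functional g -> N (tval g (repr (\pi_tensor s)) - tval g s).
Proof. by move: g; apply/tensorP; rewrite reprK. Qed.

Lemma tensor_add_pi (s t : tensor_pre) :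
  tensor_add (\pi_tensor s) (\pi_tensor t) = \pi_tensor (s ++ t : tensor_pre).
Proof.
apply/tensorP => g gF; rewrite !tval_cat.
by have := ND (repr_eqv s gF) (repr_eqv t gF); congr N; ring.
Qed.

Lemma tensor_opp_pi (s : tensor_pre) :
  tensor_opp (\pi_tensor s) = \pi_tensor (topp s : tensor_pre).
Proof.
apply/tensorP => g gF; rewrite !tval_topp.
by have := NN (repr_eqv s gF); congr N; ring.
Qed.

Lemma tensor_delta_pi i (s : tensor_pre) :
  tensor_delta i (\pi_tensor s) = \pi_tensor (tdelta i s : tensor_pre).
Proof.
apply/tensorP => g gF; rewrite !tval_tdelta.
have := NB (Ndelta i (repr_eqv s gF)) (repr_eqv s (functional_delta i gF)).
by rewrite deltaB; congr N; ring.
Qed.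

Lemma tmulC g s t : tval g (tmul s t) = tval g (tmul t s).
Proof.
rewrite !tval_tmul exchange_big; apply: eq_bigr => q _; apply: eq_bigr => p _.
by rewrite [p.2 * _]mulrC; ring.
Qed.

Lemma tensor_mul_pi (s t : tensor_pre) :
  tensor_mul (\pi_tensor s) (\pi_tensor t) = \pi_tensor (tmul s t : tensor_pre).
Proof.
have half (s1 s2 u : tensor_pre) : \pi_tensor s1 = \pi_tensor s2 ->
    \pi_tensor (tmul s1 u : tensor_pre) = \pi_tensor (tmul s2 u : tensor_pre).
  move=> /tensorP s12; apply/tensorP => g gF; rewrite !tval_tmulr -sumrB.
  by apply: N_sum => q; rewrite -mulrBr; apply: Nev; apply: s12; exact: functionalM.
have comm (s1 s2 : tensor_pre) : \pi_tensor (tmul s1 s2 : tensor_pre) = \pi_tensor (tmul s2 s1 : tensor_pre).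
  by apply: tensor_eq => g; exact: tmulC.
rewrite /tensor_mul (half _ s); last by rewrite reprK.
by rewrite comm (half _ t) ?reprK // comm.
Qed.

Local Notation tensor0 := (\pi_tensor ([::] : tensor_pre)).
Local Notation tensor1 := (\pi_tensor ([:: (TC 1, 1)] : tensor_pre)).

Lemma tensor_addA : associative tensor_add.
Proof.
move=> a b c; elim/tensorW: a => a; elim/tensorW: b => b; elim/tensorW: c => c.
by rewrite !tensor_add_pi; apply: tensor_eq => g; rewrite !tval_cat; ring.
Qed.

Lemma tensor_addC : commutative tensor_add.
Proof.
move=> a b; elim/tensorW: a => a; elim/tensorW: b => b.
by rewrite !tensor_add_pi; apply: tensor_eq => g; rewrite !tval_cat; ring.
Qed.

Lemma tensor_add0 : left_id tensor0 tensor_add.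
Proof. by move=> a; elim/tensorW: a => a; rewrite tensor_add_pi. Qed.

Lemma tensor_addN : left_inverse tensor0 tensor_opp tensor_add.
Proof.
move=> a; elim/tensorW: a => a; rewrite tensor_opp_pi tensor_add_pi; apply: tensor_eq => g.
by rewrite tval_cat tval_topp tval_nil; ring.
Qed.

HB.instance Definition _ := GRing.isZmodule.Build tensor
  tensor_addA tensor_addC tensor_add0 tensor_addN.

Lemma tensor_mulA : associative tensor_mul.
Proof.
move=> a b c; elim/tensorW: a => a; elim/tensorW: b => b; elim/tensorW: c => c.
rewrite !tensor_mul_pi; apply: tensor_eq => g; rewrite !tval_tmul big_allpairs_dep.
apply: eq_bigr => p _; rewrite big_allpairs_dep; apply: eq_bigr => q _.
by apply: eq_bigr => r _ /=; rewrite !mulrA.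
Qed.

Lemma tensor_mulC : commutative tensor_mul.
Proof.
move=> a b; elim/tensorW: a => a; elim/tensorW: b => b.
by rewrite !tensor_mul_pi; apply: tensor_eq => g; exact: tmulC.
Qed.

Lemma tensor_mul1 : left_id tensor1 tensor_mul.
Proof.
move=> a; elim/tensorW: a => a; rewrite tensor_mul_pi; apply: tensor_eq => g.
rewrite tval_tmul big_seq1 /=; apply: eq_bigr => p _.
by rewrite (dhom1 phiT) !mul1r.
Qed.

Lemma tensor_mulDl : left_distributive tensor_mul tensor_add.
Proof.
move=> a b c; elim/tensorW: a => a; elim/tensorW: b => b; elim/tensorW: c => c.
rewrite !(tensor_mul_pi, tensor_add_pi); apply: tensor_eq => g.
by rewrite tval_cat !tval_tmul big_cat.
Qed.

Hypothesis N1 : ~ N 1.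

Lemma tensor_1neq0 : tensor1 != tensor0.
Proof.
apply/eqP => /tensorP h; have [g gF g1] := functional_exists; apply: N1.
have := h g gF; rewrite tval_cons !tval_nil /= (dhom1 phiT) mul1r addr0 subr0 => Ng.
by have := NB Ng (Nker g1); congr N; ring.
Qed.

HB.instance Definition _ := GRing.Zmodule_isComNzRing.Build tensor
  tensor_mulA tensor_mulC tensor_mul1 tensor_mulDl tensor_1neq0.

Lemma tensor_deltaD i (a b : tensor) :
  tensor_delta i (a + b) = tensor_delta i a + tensor_delta i b.
Proof.
elim/tensorW: a => a; elim/tensorW: b => b.
rewrite [z in tensor_delta i z]tensor_add_pi !tensor_delta_pi [RHS]tensor_add_pi.
apply: tensor_eq => g; rewrite tval_cat !tval_tdelta !tval_cat deltaD; ring.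
Qed.

Lemma tval_tdeltaE g i s : tval g (tdelta i s) =
  \sum_(p <- s) (delta i (ev p.1) * g p.2 + ev p.1 * g (delta i p.2)).
Proof.
elim: s => [|p s IH]; first by rewrite tval_nil big_nil.
by rewrite [tdelta _ _]/= !tval_cons IH big_cons /=; ring.
Qed.

Lemma sum_tdelta (h : term * L -> K) i s : \sum_(p <- tdelta i s) h p =
  \sum_(p <- s) (h (TD i p.1, p.2) + h (p.1, delta i p.2)).
Proof.
elim: s => [|p s IH]; first by rewrite !big_nil.
by rewrite [tdelta _ _]/= !big_cons IH addrA.
Qed.

Lemma tensor_deltaM i (a b : tensor) :
  tensor_delta i (a * b) = tensor_delta i a * b + a * tensor_delta i b.
Proof.
elim/tensorW: a => a; elim/tensorW: b => b.
rewrite [z in tensor_delta i z]tensor_mul_pi !tensor_delta_pi.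
rewrite [X in X + _]tensor_mul_pi [X in _ + X]tensor_mul_pi [RHS]tensor_add_pi.
apply/tensorP => g gF; rewrite tval_cat !tval_tmul tval_tdeltaE big_allpairs_dep sum_tdelta.
rewrite -big_split -sumrB; apply: N_sum => p /=.
rewrite sum_tdelta -!big_split -sumrB; apply: N_sum => q /=.
have := Nev p.1 (Nev q.1 (Nker (fun_add gF (delta i p.2 * q.2) (p.2 * delta i q.2)))).
by rewrite !deltaM; congr N; ring.
Qed.

Lemma tensor_deltaC i j (a : tensor) :
  tensor_delta i (tensor_delta j a) = tensor_delta j (tensor_delta i a).
Proof.
elim/tensorW: a => a; rewrite !tensor_delta_pi; apply: tensor_eq => g.
rewrite !tval_tdeltaE !sum_tdelta; apply: eq_bigr => p _ /=.
by rewrite !(deltaC i j); ring.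
Qed.

HB.instance Definition _ := hasDerivations.Build m tensor
  tensor_deltaD tensor_deltaM tensor_deltaC.

Definition tensor_in (l : L) : tensor := \pi_tensor ([:: (TC 1, l)] : tensor_pre).

Lemma tensor_in_dhom : dhom_on setT tensor_in.
Proof.
apply: dhom_onT => [//|l l'|l l'|i l].
- rewrite [RHS]tensor_add_pi; apply/tensorP => g gF.
  rewrite !tval_cons tval_nil /= (dhom1 phiT) !mul1r !addr0.
  by apply: Nker; exact: fun_add gF _ _.
- rewrite [RHS]tensor_mul_pi; apply: tensor_eq => g.
  by rewrite !tval_cons tval_nil /= (dhom1 phiT) !mul1r.
- rewrite [RHS]tensor_delta_pi; apply: tensor_eq => g.
  by rewrite !tval_cons tval_nil /= (dhom1 phiT) delta1 mul0r add0r.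
Qed.

Inductive trep : K -> seq (term * L) -> Prop :=
| trep0 : trep 0 [::]
| trepS r t z s : R r -> trep z s -> trep (r * ev t + z) ((t, f r) :: s).

Definition adjoin : set K := [set z | exists s, trep z s].

(** Modulo m one has g(f r) = r g(1), so the value of g on a representation depends only on [z].
    Thus sending [z] to its tensor is well defined on R{x}. *)
Lemma trep_tval z s g : trep z s -> functional g -> N (tval g s - z * g 1).
Proof.
move=> zs gF; elim: zs => [|r t {}z {}s Rr _ IH].
  by rewrite tval_nil mul0r subrr; exact: dspan0.
have := ND (Nev t (Nker (fun_scale gF 1 Rr))) IH; rewrite mulr1 tval_cons /=.
by congr N; ring.
Qed.

Lemma trep_uniq z (s s' : tensor_pre) : trep z s -> trep z s' -> \pi_tensor s = \pi_tensor s'.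
Proof.
move=> zs zs'; apply/tensorP => g gF.
by have := NB (trep_tval zs gF) (trep_tval zs' gF); congr N; ring.
Qed.

Lemma trepD z z' s s' : trep z s -> trep z' s' -> trep (z + z') (s ++ s').
Proof.
move=> + zs'; elim=> [|r t {}z {}s Rr _ IH]; first by rewrite add0r.
by rewrite -addrA; exact: trepS.
Qed.

Lemma trep_scale r t z s : R r -> trep z s ->
  trep (r * ev t * z) [seq (TM t q.1, f r * q.2) | q <- s].
Proof.
move=> Rr; elim=> [|r' t' {}z {}s Rr' _ IH]; first by rewrite mulr0; exact: trep0.
rewrite mulrDr (_ : r * ev t * (r' * ev t') = (r * r') * ev (TM t t')); last first.
  by rewrite /=; ring.
rewrite [map _ _]/= -(dhomM fR) //; apply: trepS => //; exact: (dhom_domM fR).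
Qed.

Lemma trepM z z' s s' : trep z s -> trep z' s' -> trep (z * z') (tmul s s').
Proof.
move=> + zs'; elim=> [|r t {}z {}s Rr _ IH]; first by rewrite mul0r; exact: trep0.
by rewrite mulrDl; apply: trepD => //; exact: trep_scale.
Qed.

Lemma trep_delta i z s : trep z s -> trep (delta i z) (tdelta i s).
Proof.
elim=> [|r t {}z {}s Rr _ IH]; first by rewrite delta0; exact: trep0.
rewrite (_ : delta i _ = r * ev (TD i t) + (delta i r * ev t + delta i z)); last first.
  by rewrite deltaD deltaM /=; ring.
rewrite [tdelta _ _]/= -(dhom_delta fR) //.
by apply: trepS => //; apply: trepS => //; exact: (dhom_dom_delta fR).
Qed.

Lemma trep_dom r : R r -> trep r [:: (TC 1, f r)].
Proof.
move=> Rr; have := trepS (TC 1) Rr trep0.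
by rewrite /= (dhom1 phiT) mulr1 addr0.
Qed.

Lemma adjoin_dom r : R r -> adjoin r.
Proof. by move=> /trep_dom; exists [:: (TC 1, f r)]. Qed.

Lemma adjoin_ev t : adjoin (ev t).
Proof.
exists [:: (t, f 1)]; have := trepS t (dhom_dom1 fR) trep0.
by rewrite mul1r addr0.
Qed.

Lemma extend_to_adjoin : exists (L' : diffFieldType m) (j : L -> L') (f' : K -> L'),
  [/\ dhom_on setT j, dhom_on adjoin f' & forall r, R r -> f' r = j (f r)].
Proof.
have [|L' [pi piT]] := @dfield_of_dring m tensor.
  (* Positive integers are invertible in L, hence in the tensor product, which receives a
     homomorphism from L. *)
  move=> k; exists (tensor_in k.+1%:R^-1); have jT := tensor_in_dhom.
  rewrite -(dhom_natr _ jT) -(dhomM jT) // mulVf ?(dhom1 jT) //.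
  exact: pchar0_natr_neq0.
pose f' z := match pselect (adjoin z) with
  | left h => pi (\pi_tensor (projT1 (cid h) : tensor_pre)) | right _ => 0 end.
have f'E z s : trep z s -> f' z = pi (\pi_tensor (s : tensor_pre)).
  move=> zs; rewrite /f'; case: pselect => [h|[]]; last by exists s.
  by congr pi; apply: trep_uniq zs; case: (cid h).
exists L', (pi \o tensor_in), f'; split.
- exact: dhom_comp tensor_in_dhom piT _.
- have rN1 : R (-1) by apply: (dhom_domN fR); exact: dhom_dom1 fR.
  split.
  + exact: adjoin_dom (dhom_dom1 fR).
  + move=> z z' [s zs] [s' zs']; exists (s ++ [seq (TM (TC 1) q.1, f (-1) * q.2) | q <- s']).
    have := trep_scale (TC 1) rN1 zs'; rewrite /= (dhom1 phiT) mulr1 mulN1r.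
    exact: trepD.
  + by move=> z z' [s zs] [s' zs']; exists (tmul s s'); exact: trepM.
  + by move=> i z [s zs]; exists (tdelta i s); exact: trep_delta.
  + rewrite (f'E _ _ (trep_dom (dhom_dom1 fR))) (dhom1 fR); exact: dhom1 piT.
  + move=> z z' [s zs] [s' zs']; rewrite (f'E _ _ zs) (f'E _ _ zs') (f'E _ _ (trepD zs zs')).
    by rewrite -(dhomD piT) //; congr pi; rewrite [RHS]tensor_add_pi.
  + move=> z z' [s zs] [s' zs']; rewrite (f'E _ _ zs) (f'E _ _ zs') (f'E _ _ (trepM zs zs')).
    by rewrite -(dhomM piT) //; congr pi; rewrite [RHS]tensor_mul_pi.
  + move=> i z [s zs]; rewrite (f'E _ _ zs) (f'E _ _ (trep_delta i zs)).
    by rewrite -(dhom_delta piT) //; congr pi; rewrite [RHS]tensor_delta_pi.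
- by move=> r /trep_dom /f'E ->.
Qed.

End Adjunction.

(** * From completeness to the valuative criterion *)

Lemma delta_div (m : nat) (K : diffFieldType m) i (a b : K) : b != 0 ->
  delta i (a / b) = (delta i a * b - a * delta i b) / (b * b).
Proof.
move=> b0; have := deltaM i (a / b) b; rewrite divfK // => ->.
by field.
Qed.

Definition Htriple_of_dhom (m : nat) (K L : diffFieldType m) (A : set K) (f : K -> L)
    (fA : dhom_on A f) : Htriple K :=
  Build_Htriple (dhom_dom1 fA) (@dhom_domB _ _ _ _ _ fA) (@dhom_domM _ _ _ _ _ fA)
    (@dhom_dom_delta _ _ _ _ _ fA) (dhom1 fA) (@dhomD _ _ _ _ _ fA) (@dhomM _ _ _ _ _ fA)
    (@dhom_delta _ _ _ _ _ fA).

Lemma Hmaximal_dhom (m : nat) (K L' : diffFieldType m) (T : Htriple K) (A : set K)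
    (f' : K -> L') (j : Hcod T -> L') :
  Hmaximal T -> dhom_on A f' -> dhom_on setT j -> Hdom T `<=` A ->
  (forall r, Hdom T r -> f' r = j (@Hmap m K T r)) -> A `<=` Hdom T.
Proof.
move=> Tmax f'A jT TA f'j; have [g gd gE] := rmorphism_of_dhom jT.
have <- : A = Hdom T; last by [].
apply: (Tmax (Htriple_of_dhom f'A)); split=> //; exists g => // r Tr.
by rewrite [LHS]f'j // gE.
Qed.

Section MaximalTriple.
Variables (m : nat) (K : diffFieldType m) (T : Htriple K).
Hypothesis Tmax : Hmaximal T.
Local Notation R := (Hdom T).
Local Notation f := (@Hmap m K T).
Let fR := Htriple_dhom T.

(** [f] extends to the localization of R at its kernel, realized inside K as the quotients a/b with
    f b nonzero. By maximality this localization is already R. *)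
Lemma Hmaximal_local r : R r -> f r <> 0 -> R r^-1.
Proof.
move=> Rr fr.
pose fr_of z a b := [/\ R a, R b, f b != 0 & z = a / b].
pose A : set K := [set z | exists a b, fr_of z a b].
pose g z : Hcod T := match pselect (A z) with
  | left h => f (projT1 (cid h)) / f (projT1 (cid (projT2 (cid h)))) | right _ => 0 end.
have nz b : f b != 0 -> b != 0.
  by apply: contra_neq => ->; exact: dhom0 fR.
have gE z a b : fr_of z a b -> g z = f a / f b.
  move=> zab; rewrite /g; case: pselect => [h|[]]; last by exists a, b.
  case: (cid (projT2 (cid h))); case: (cid h) => /= a' _ b' [Ra' Rb' fb' e'].
  case: zab => [Ra Rb fb e]; apply/eqP; rewrite eqr_div // -!(dhomM fR) //; apply/eqP.
  congr f; apply/eqP; rewrite -eqr_div ?nz // -e -e' //.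
have frR a : R a -> fr_of a a 1.
  move=> Ra; split; [by []|exact: dhom_dom1 fR| |by rewrite divr1].
  by rewrite (dhom1 fR) oner_eq0.
have frB z a b z' a' b' : fr_of z a b -> fr_of z' a' b' ->
    fr_of (z - z') (a * b' - a' * b) (b * b').
  move=> [Ra Rb fb ->] [Ra' Rb' fb' ->].
  split; [|exact: (dhom_domM fR)|by rewrite (dhomM fR) // mulf_neq0|].
    by apply: (dhom_domB fR); exact: (dhom_domM fR).
  by field; rewrite !nz.
have frM z a b z' a' b' : fr_of z a b -> fr_of z' a' b' -> fr_of (z * z') (a * a') (b * b').
  move=> [Ra Rb fb ->] [Ra' Rb' fb' ->].
  split; [exact: (dhom_domM fR)|exact: (dhom_domM fR)|by rewrite (dhomM fR) // mulf_neq0|].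
  by field; rewrite !nz.
have frD z a b z' a' b' : fr_of z a b -> fr_of z' a' b' ->
    fr_of (z + z') (a * b' + a' * b) (b * b').
  move=> [Ra Rb fb ->] [Ra' Rb' fb' ->].
  split; [|exact: (dhom_domM fR)|by rewrite (dhomM fR) // mulf_neq0|].
    by apply: (dhom_domD fR); exact: (dhom_domM fR).
  by field; rewrite !nz.
have frd i z a b : fr_of z a b -> fr_of (delta i z) (delta i a * b - a * delta i b) (b * b).
  move=> [Ra Rb fb ->]; have Rd := dhom_dom_delta fR.
  split; [|exact: (dhom_domM fR)|by rewrite (dhomM fR) // mulf_neq0|by rewrite delta_div ?nz].
  by apply: (dhom_domB fR); apply: (dhom_domM fR) => //; exact: Rd.
have gA : dhom_on A g.
  split.
  - by exists 1, 1; apply: frR; exact: dhom_dom1 fR.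
  - by move=> z z' [a [b zab]] [a' [b' zab']]; eexists; eexists; exact: frB zab zab'.
  - by move=> z z' [a [b zab]] [a' [b' zab']]; eexists; eexists; exact: frM zab zab'.
  - by move=> i z [a [b zab]]; eexists; eexists; exact: frd zab.
  - by rewrite (gE _ _ _ (frR _ (dhom_dom1 fR))) (dhom1 fR) divr1.
  - move=> z z' [a [b zab]] [a' [b' zab']]; rewrite (gE _ _ _ (frD _ _ _ _ _ _ zab zab')).
    rewrite (gE _ _ _ zab) (gE _ _ _ zab'); case: zab zab' => [? ? ? _] [? ? ? _].
    rewrite (dhomD fR) ?(dhomM fR) //; [|exact: (dhom_domM fR)..].
    by field; apply/andP.
  - move=> z z' [a [b zab]] [a' [b' zab']]; rewrite (gE _ _ _ (frM _ _ _ _ _ _ zab zab')).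
    rewrite (gE _ _ _ zab) (gE _ _ _ zab'); case: zab zab' => [? ? ? _] [? ? ? _].
    rewrite !(dhomM fR) //.
    by field; apply/andP.
  - move=> i z [a [b zab]]; rewrite (gE _ _ _ (frd i _ _ _ zab)) (gE _ _ _ zab).
    case: zab => [Ra Rb fb _]; have Rd := dhom_dom_delta fR i.
    rewrite delta_div // (dhomB fR) ?(dhomM fR) ?(dhom_delta fR) //; try exact: Rd.
      by apply: (dhom_domM fR) => //; exact: Rd.
    by apply: (dhom_domM fR) => //; exact: Rd.
apply: (Hmaximal_dhom Tmax gA (dhom_idfun _)).
- by move=> a Ra; exists a, 1; exact: frR.
- by move=> a Ra; rewrite (gE _ _ _ (frR _ Ra)) (dhom1 fR) divr1.
- exists 1, r; split=> //; [exact: dhom_dom1 fR|exact/eqP|by rewrite div1r].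
Qed.

Lemma Hmaximal_adjoin (F : diffFieldType m) (J : Type) (phi : F -> K) (x : J -> K) :
  dhom_on setT phi -> (forall c, R (phi c)) -> [pchar F] =i pred0 ->
  ~ dker_span phi x R f 1 -> forall i, R (x i).
Proof.
move=> phiT phiR F0 N1 i.
have L0 : [pchar (Hcod T)] =i pred0 by exact: pchar0_dhom (dhom_comp phiT fR phiR) F0.
have [L' [j [f' [jT f'A f'j]]]] := extend_to_adjoin phiT fR Hmaximal_local L0 N1.
apply: (Hmaximal_dhom Tmax f'A jT) => //; first by move=> r; exact: adjoin_dom.
exact: (adjoin_ev phi x fR (TV i)).
Qed.

End MaximalTriple.

Lemma dspan_sum (m : nat) (F K : diffFieldType m) (J : Type) (phi : F -> K) (x : J -> K)
    (A : set K) z : dspan phi x A z ->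
  exists k (r : 'I_k -> K) (t : 'I_k -> dterm m F J),
    (forall j, A (r j)) /\ z = \sum_j r j * teval phi x (t j).
Proof.
elim=> [|r t {}z Ar _ [k [rs [ts [Ars ->]]]]].
  by exists 0%N, (fun=> 0), (fun=> TC 0); split=> [[]//|]; rewrite big_ord0.
exists k.+1, (fun j => if unlift ord0 j is Some l then rs l else r),
  (fun j => if unlift ord0 j is Some l then ts l else t); split.
  by move=> j; case: unliftP => [l _|_].
rewrite big_ord_recl /= unlift_none; congr (_ + _).
by apply: eq_bigr => j _; rewrite liftK.
Qed.

Lemma dhomog_dterm (m : nat) (F : diffFieldType m) (I : choiceType) (w : pred I) d
    (t : dterm m F I) :
  (forall (S : diffRingType m) (phi : F -> S), dhom_on setT phi -> forall (c : S) (x : I -> S),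
    teval phi (fun i => if w i then c * x i else x i) t = c ^+ d * teval phi x t) ->
  dhomog w d (dpoly_of_dterm t).
Proof.
move=> ht S phi phid c x; rewrite !deval_dpoly_of_dterm //.
exact: ht (dhom_rmorphism phid) _ _.
Qed.

Lemma deval_idfun_dterm (m : nat) (F : diffFieldType m) (I : choiceType) (x : I -> F)
    (t : dterm m F I) : deval idfun x (dpoly_of_dterm t) = teval idfun x t.
Proof. exact: (deval_dpoly_of_dterm (phi := (idfun : {rmorphism F -> F}))). Qed.

Lemma eq_pair_coord (m : nat) (F : diffFieldType m) n N (z : 'I_n + 'I_N.+1 -> F) :
  pair_coord (z \o inl) (z \o inr) = z.
Proof. by apply: funext; case. Qed.

(** Projective space is itself minus the empty closed set, cut out by the constant 1, which is
    homogeneous of degree 0. *)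
Lemma quasiprojT (m : nat) (F : diffFieldType m) N :
  quasiproj [set y : 'I_N.+1 -> F | exists i, y i <> 0].
Proof.
set Y := [set y | _]; exists (Y `&` dzeros idfun set0),
  (Y `&` dzeros idfun [set dpoly_of_dterm (TC 1)]); split.
- by exists set0.
- exists [set dpoly_of_dterm (TC 1)] => // _ ->; exists 0%N; apply: dhomog_dterm.
  by move=> S phi _ c x; rewrite expr0 mul1r.
- apply/seteqP; split=> [y Yy|y [[]]] //; split; first by split=> // p.
  by move=> [_ /(_ _ erefl)]; rewrite deval_idfun_dterm /= => /eqP; rewrite oner_eq0.
Qed.

Lemma complete_valuative (m n : nat) (F : diffFieldType m) (P : set (dpoly F 'I_n)) :
  DCF0 F -> dcomplete (dzeros idfun P) ->
  forall (K : diffFieldType m) (phi : F -> K), dhom_on setT phi ->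
  forall T : Htriple K, Hmaximal T -> (forall c, Hdom T (phi c)) ->
  forall x : 'I_n -> K, dzeros phi P x -> forall i, Hdom T (x i).
Proof.
move=> FC Xc K phi phiT T Tmax phiR x Px.
apply: (Hmaximal_adjoin Tmax phiT phiR) => [|N1]; first by case: FC.
have [k [r [t [kr e1]]]] := dspan_sum N1.
have idT := dhom_idfun F; have fR := Htriple_dhom T.
pose J := ('I_n + 'I_k.+1)%type.
(* The incidence equation of the overview, with last coordinate [ord_max]; it is homogeneous of
   degree 1 in y. *)
pose q : dterm m F J := TA (tsum [seq TM (TV (inr (widen_ord (leqnSn k) j))) (tmap id inl (t j))
  | j <- enum 'I_k]) (TM (TC (-1)) (TV (inr ord_max))).
have qE (S : diffRingType m) (psi : F -> S) (z : J -> S) : dhom_on setT psi ->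
    teval psi z q = \sum_j z (inr (widen_ord (leqnSn k) j)) * teval psi (z \o inl) (t j)
      - z (inr ord_max).
  move=> psiT; rewrite /= teval_tsum // big_map big_enum (dhomN psiT) // (dhom1 psiT) mulN1r.
  by congr (_ - _); apply: eq_bigr => j _; rewrite /= teval_tmap.
pose Y := [set y : 'I_k.+1 -> F | exists i, y i <> 0].
pose Z := [set z : ('I_n -> F) * ('I_k.+1 -> F) | [/\ dzeros idfun P z.1, Y z.2 &
  dzeros idfun [set dpoly_of_dterm q] (pair_coord z.1 z.2)]].
have [|C [Pc Pch CE] ZE] := Xc k Y (quasiprojT F k) Z.
  exists [set dpoly_of_dterm q] => // _ ->; exists 1%N; apply: dhomog_dterm => S psi psiT c z.
  rewrite !qE // expr1 mulrBr mulr_sumr; congr (_ - _).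
  by apply: eq_bigr => j _ /=; rewrite mulrA.
pose y (j : 'I_k.+1) : K := if unlift ord_max j is Some l then r l else 1.
have ymax : y ord_max = 1 by rewrite /y unlift_none.
have ywid j : y (widen_ord (leqnSn k) j) = r j.
  rewrite /y (_ : widen_ord _ j = lift ord_max j) ?liftK //.
  by apply: val_inj; rewrite /= /bump leqNgt ltn_ord.
pose z (s : J) : K := match s with inl i => x i | inr j => y j end.
have zq : teval phi z q = 0.
  rewrite qE // /z ymax [X in _ - X]e1 -sumrB big1 // => j _.
  by rewrite ywid subrr.
(* Closedness concerns F-points only. If G did not vanish at [y], specializing [(x, y)] to F while
   keeping G nonzero would give a point of the projection outside C; the relation y_max = 1
   survives, so that point is nonzero. *)
have Gy G : Pc G -> deval phi y G = 0.
  move=> PcG; apply: contrapT => Gy.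
  have [|z' hz' z'0] := @DCF0_specialize m J F K phi z (tmap id inr (term_of_dpoly G)) FC phiT.
    by rewrite teval_tmap -deval_term.
  apply: hz'; rewrite teval_tmap -deval_term //.
  have : (snd @` Z) (z' \o inr).
    exists (z' \o inl, z' \o inr) => //; split=> /=.
    - move=> p Pp; have := z'0 (tmap id inl (term_of_dpoly p)).
      rewrite !teval_tmap => h; rewrite deval_term //; apply: h.
      exact: etrans (esym (deval_term x phiT p)) (Px _ Pp).
    - exists ord_max => /=.
      have := z'0 (TA (TV (inr ord_max)) (TC (-1))); rewrite /= ymax (dhomN phiT) // (dhom1 phiT) subrr.
      by move=> /(_ erefl) /subr0_eq ->; exact/eqP/oner_neq0.
    - by move=> _ ->; rewrite eq_pair_coord deval_idfun_dterm; exact: z'0.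
  by rewrite ZE CE => -[_ [_ /(_ _ PcG)]].
have psiT := dhom_comp phiT fR phiR.
(* The image of [y] under the homomorphism: the r_j lie in its kernel and the last coordinate is 1.
   Its coordinates lie in F, so G is evaluated there and compared through the embedding of F in the
   codomain. *)
pose y0 (j : 'I_k.+1) : F := (j == ord_max)%:R.
have : (Y `&` C) y0.
  have Yy0 : Y y0 by exists ord_max; rewrite /y0 eqxx; exact/eqP/oner_neq0.
  split=> //; rewrite CE; split=> // G PcG; apply: (dhom_inj psiT).
  rewrite (dhom0 psiT) deval_term // (teval_dhom _ psiT) //.
  have := congr1 (@Hmap m K T) (Gy _ PcG); rewrite deval_term // (dhom0 fR).
  have yR j : Hdom T (y j).
    by rewrite /y; case: unliftP => [l _|_]; [case: (kr l)|exact: dhom_dom1 fR].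
  rewrite (teval_dhom _ fR) // => <-; apply: eq_teval => // j /=.
  rewrite /y0 /y; case: unliftP => [l ->|->] /=.
    by rewrite eq_sym (negPf (neq_lift _ _)) /= mulr0n (dhom0 phiT) (dhom0 fR); case: (kr l).
  by rewrite eqxx mulr1n (dhom1 phiT) (dhom1 fR).
rewrite -ZE => -[[x' y'] [_ _ /(_ _ erefl)]] /= + y'0.
rewrite {}y'0 deval_idfun_dterm qE // big1 => [|j _].
  by rewrite /= /y0 eqxx sub0r => /eqP; rewrite oppr_eq0 oner_eq0.
rewrite /= /y0 (_ : (_ == _) = false) ?mul0r //.
by apply/negbTE; rewrite -val_eqE /= ltn_eqF.
Qed.

(** * From the valuative criterion to completeness *)

Lemma mulr_deltaX (m : nat) (S : diffRingType m) i (y : S) d :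
  y * delta i (y ^+ d) = d%:R * (y ^+ d * delta i y).
Proof.
case: d => [|d]; first by rewrite expr0 delta1 mulr0 mul0r.
by rewrite deltaX exprS mulr_natl mulrnAr mulrA.
Qed.

(** Clears denominators in a differential term of the affine coordinates y_i / y_j. Sums are brought
    to a common degree with powers of y_j; derivatives need the quotient rule. *)
Lemma homogenize (m N : nat) (F : diffFieldType m) (j : 'I_N.+1) (t : dterm m F 'I_N.+1) :
  exists d g,
    (forall (S : diffRingType m) (phi : F -> S), dhom_on setT phi -> forall (c : S) y,
      teval phi (fun i => c * y i) g = c ^+ d * teval phi y g) /\
    (forall y : 'I_N.+1 -> F, y j != 0 ->
      teval idfun y g = y j ^+ d * teval idfun (fun i => y i / y j) t).
Proof.
have idT := dhom_idfun F.
elim: t => [c|i|k t [d [g [gh gE]]]|t [d [g [gh gE]]] u [e [h [hh hE]]]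
           |t [d [g [gh gE]]] u [e [h [hh hE]]]].
- by exists 0%N, (TC c); split=> [S phi _ c' y|y _]; rewrite expr0 mul1r.
- exists 1%N, (TV i); split=> [S phi _ c y|y yj]; rewrite expr1 //=.
  by rewrite mulrC divfK.
(* If g = y_j^d s, then y_j delta(g) - d g delta(y_j) = y_j^(d+1) delta(s): hence the correction
   term and the rise of the degree by one. *)
- exists d.+1, (TA (TM (TV j) (TD k g)) (TM (TC (- d%:R)) (TM g (TD k (TV j))))).
  split=> [S phi phiT c y|y yj] /=.
    rewrite gh // (dhomN phiT) // (dhom_natr _ phiT) !deltaM exprS.
    have := mulr_deltaX k c d; set D := delta k (c ^+ d) => cD.
    (* A cancelling pair is inserted so that the relation for c delta(c^d) can be used on one of its
       halves; what remains is a ring identity. *)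
    rewrite -[LHS]addr0 -[X in _ + X](subrr (y j * teval phi y g * (c * D))).
    by rewrite {1}cD; ring.
  rewrite gE // !deltaM exprS.
  have := mulr_deltaX k (y j) d; set D := delta k (y j ^+ d) => cD.
  rewrite -[LHS]addr0 -[X in _ + X](subrr (teval idfun (fun i => y i / y j) t * (y j * D))).
  by rewrite {1}cD; ring.
- exists (d + e)%N, (TA (TM g (texp (TV j) e)) (TM h (texp (TV j) d))).
  split=> [S phi phiT c y|y yj]; rewrite /= !teval_texp //= ?gh ?hh ?gE ?hE //.
    by rewrite !exprMn exprD; ring.
  by rewrite exprD; ring.
- exists (d + e)%N, (TM g h).
  split=> [S phi phiT c y|y yj]; rewrite /= ?gh ?hh ?gE ?hE // exprD; ring.
Qed.

Section PrimePairs.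
Variables (m : nat) (K : diffFieldType m).

(* A pair (A, p) of a subring and a prime ideal is encoded as p x {true} U (A \ p) x {false},
   so that inclusion of codes is extension of subrings with p = p' n A. *)
Definition pair_ring (W : set (K * bool)) : set K := [set z | exists b, W (z, b)].

Record prime_pair (W : set (K * bool)) : Prop := {
  pp_disj : forall z, W (z, true) -> W (z, false) -> False;
  pp1 : W (1, false);
  pp0 : W (0, true);
  ppB : forall z z', pair_ring W z -> pair_ring W z' -> pair_ring W (z - z');
  pp_delta : forall i z, pair_ring W z -> pair_ring W (delta i z);
  pp_idealB : forall z z', W (z, true) -> W (z', true) -> W (z - z', true);
  pp_idealM : forall z z', pair_ring W z -> W (z', true) -> W (z * z', true);
  pp_ideal_delta : forall i z, W (z, true) -> W (delta i z, true);
  pp_prime : forall z z', W (z, false) -> W (z', false) -> W (z * z', false)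
}.

Lemma pp_ringM W : prime_pair W ->
  forall z z', pair_ring W z -> pair_ring W z' -> pair_ring W (z * z').
Proof.
move=> ppW z z' [b Wz] [b' Wz']; case: b' Wz' => Wz'.
  by exists true; apply: (pp_idealM ppW) => //; exists b.
case: b Wz => Wz; last by exists false; exact: (pp_prime ppW).
by exists true; rewrite mulrC; apply: (pp_idealM ppW) => //; exists false.
Qed.

Lemma prime_pair_dhom (L : diffFieldType m) (A : set K) (f : K -> L) : dhom_on A f ->
  prime_pair [set p | A p.1 /\ (p.2 = (f p.1 == 0))].
Proof.
move=> fA; have f0 := dhom0 fA.
have RA z : pair_ring [set p | A p.1 /\ (p.2 = (f p.1 == 0))] z -> A z by case=> b [].
have AR z : A z -> pair_ring [set p | A p.1 /\ (p.2 = (f p.1 == 0))] z.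
  by move=> Az; exists (f z == 0).
split=> /=.
- by move=> z [_ /esym z0] [_]; rewrite z0.
- by split; [exact: dhom_dom1 fA|rewrite (dhom1 fA) oner_eq0].
- by split; [exact: (dhom_dom0 fA)|rewrite f0 eqxx].
- by move=> z z' /RA Az /RA Az'; apply: AR; exact: (dhom_domB fA).
- by move=> i z /RA Az; apply: AR; exact: (dhom_dom_delta fA).
- move=> z z' [Az /esym/eqP z0] [Az' /esym/eqP z0']; split; first exact: (dhom_domB fA).
  by rewrite (dhomB fA) // z0 z0' subrr eqxx.
- move=> z z' /RA Az [Az' /esym/eqP z0']; split; first exact: (dhom_domM fA).
  by rewrite (dhomM fA) // z0' mulr0 eqxx.
- move=> i z [Az /esym/eqP z0]; split; first exact: (dhom_dom_delta fA).
  by rewrite (dhom_delta fA) // z0 delta0 eqxx.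
- move=> z z' [Az z0] [Az' z0']; split; first exact: (dhom_domM fA).
  by rewrite (dhomM fA) // mulf_eq0 -z0 -z0'.
Qed.

Lemma prime_pair_chain (C : set (set (K * bool))) : C !=set0 -> C `<=` prime_pair ->
  total_on C subset -> prime_pair (\bigcup_(X in C) X).
Proof.
move=> [X0 CX0] Cpp totC; pose U := \bigcup_(X in C) X.
have common p q : U p -> U q -> exists X, [/\ C X, X p & X q].
  move=> [X CX Xp] [Y CY Yq]; case: (totC _ _ CX CY) => h.
    by exists Y; split=> //; exact: h.
  by exists X; split=> //; exact: h.
have up X p : C X -> X p -> U p by move=> CX Xp; exists X.
split.
- by move=> z h1 h2; have [X [/Cpp pX X1 X2]] := common _ _ h1 h2; exact: pp_disj X1 X2.
- by exists X0 => //; exact: pp1 (Cpp _ CX0).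
- by exists X0 => //; exact: pp0 (Cpp _ CX0).
- move=> z z' [b h1] [b' h2]; have [X [CX X1 X2]] := common _ _ h1 h2.
  have [b'' h] := ppB (Cpp _ CX) (ex_intro _ b X1) (ex_intro _ b' X2).
  by exists b''; exact: up CX h.
- move=> i z [b [X CX Xz]]; have [b' h] := pp_delta (Cpp _ CX) i (ex_intro _ b Xz).
  by exists b'; exact: up CX h.
- move=> z z' h1 h2; have [X [CX X1 X2]] := common _ _ h1 h2.
  exact: up CX (pp_idealB (Cpp _ CX) X1 X2).
- move=> z z' [b h1] h2; have [X [CX X1 X2]] := common _ _ h1 h2.
  by apply: up CX (pp_idealM (Cpp _ CX) _ X2); exists b.
- by move=> i z [X CX Xz]; exact: up CX (pp_ideal_delta (Cpp _ CX) i Xz).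
- move=> z z' h1 h2; have [X [CX X1 X2]] := common _ _ h1 h2.
  exact: up CX (pp_prime (Cpp _ CX) X1 X2).
Qed.

(** Zorn is applied to prime pairs, which form a set of subsets of K x bool, rather than to triples
    with varying codomains. The homomorphism is recovered as the residue map of the maximal pair. *)
Lemma maximal_triple_exists W0 : prime_pair W0 -> exists2 T : Htriple K, Hmaximal T &
  pair_ring W0 `<=` Hdom T /\ forall z, W0 (z, true) -> @Hmap m K T z = 0.
Proof.
move=> pp0W; have [W [ppW W0W Wmax]] := zorn_above pp0W prime_pair_chain.
have idE : [set z | W (z, true)] `<=` pair_ring W by move=> z Wz; exists true.
have prime z z' : pair_ring W z -> pair_ring W z' -> W (z * z', true) ->
    W (z, true) \/ W (z', true).
  move=> [[] Wz]; first by left.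
  move=> [[] Wz']; first by right.
  by move=> Wzz'; case: (pp_disj ppW Wzz' (pp_prime ppW Wz Wz')).
have proper : ~ W (1, true) by move=> W1; exact: pp_disj W1 (pp1 ppW).
have ring1 : pair_ring W 1 by exists false; exact: pp1 ppW.
have [L [f [fA f0 _]]] := residue_field (DPrime (dp_ideal := [set z | W (z, true)]) ring1
  (ppB ppW) (pp_ringM ppW) (pp_delta ppW) idE (pp0 ppW) (pp_idealB ppW)
  (pp_idealM ppW) (pp_ideal_delta ppW) proper prime).
rewrite /= in fA f0; exists (Htriple_of_dhom fA); last first.
  split=> [z [b Wz]|z Wz]; first by exists b; exact: W0W.
  by apply/f0; [exists true; exact: W0W|exact: W0W].
move=> T' [sub [j _ jE]]; rewrite /= in sub jE *.
have W'pp := prime_pair_dhom (Htriple_dhom T').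
apply/seteqP; split=> // z Tz.
(* The domain and kernel of a larger triple form a prime pair. It contains W because [j] is
   injective, so the kernels agree on the smaller ring. *)
have W' : W (z, @Hmap m K T' z == 0).
  apply: (Wmax _ W'pp) => //= -[u b] Wub /=; have Au : pair_ring W u by exists b.
  split; first exact: sub.
  rewrite jE // fmorph_eq0; apply/idP/eqP => [b1|fu0].
    by apply/f0 => //; rewrite /= -b1; case: b Wub b1.
  have := (f0 _ Au).1 fu0 => /= Wt; case: b Wub => // Wf.
  by case: (pp_disj ppW Wt Wf).
by exists (@Hmap m K T' z == 0).
Qed.

End PrimePairs.

Definition valuative (m n : nat) (F : diffFieldType m) (P : set (dpoly F 'I_n)) : Prop :=
  forall (K : diffFieldType m) (phi : F -> K), DCF0 K -> dhom_on setT phi ->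
  forall T : Htriple K, Hmaximal T -> (forall c, Hdom T (phi c)) ->
  forall x : 'I_n -> K, dzeros phi P x -> forall i, Hdom T (x i).

Definition sum_coord (A B C : Type) (x : A -> C) (y : B -> C) (s : A + B) : C :=
  match s with inl i => x i | inr j => y j end.

Lemma specialization_lift (m n N : nat) (F K : diffFieldType m) (P : set (dpoly F 'I_n))
    (phi : F -> K) (x : 'I_n -> K) (w : 'I_N.+1 -> K) (w0 : 'I_N.+1 -> F) :
  DCF0 F -> valuative P -> DCF0 K -> dhom_on setT phi -> dzeros phi P x ->
  (forall t, teval phi w t = 0 -> teval idfun w0 t = 0) ->
  exists x1 : 'I_n -> F, forall t, teval phi (sum_coord x w) t = 0 ->
    teval idfun (pair_coord x1 w0) t = 0.
Proof.
move=> FC val KC phiT Px spec; have idT := dhom_idfun F.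
pose A := [set z | exists t, z = teval phi w t].
(* The specialization F{w} -> F. Independence of the chosen term follows by applying [spec] to the
   difference of two terms. *)
pose f z : F := if pselect (A z) is left h then teval idfun w0 (projT1 (cid h)) else 0.
have fE t : f (teval phi w t) = teval idfun w0 t.
  rewrite /f; case: pselect => [h|[]]; last by exists t.
  case: (cid h) => u /= tu; apply/eqP; rewrite -subr_eq0; apply/eqP.
  have := spec (TA u (TM (TC (-1)) t)) => /=.
  by rewrite tu (dhomN phiT) // (dhom1 phiT) !mulN1r subrr => ->.
have fA : dhom_on A f.
  split.
  - by exists (TC 1); rewrite /= (dhom1 phiT).
  - move=> _ _ [t ->] [u ->]; exists (TA t (TM (TC (-1)) u)).
    by rewrite /= (dhomN phiT) // (dhom1 phiT) mulN1r.
  - by move=> _ _ [t ->] [u ->]; exists (TM t u).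
  - by move=> i _ [t ->]; exists (TD i t).
  - by have := fE (TC 1); rewrite /= (dhom1 phiT).
  - by move=> _ _ [t ->] [u ->]; rewrite !fE -[RHS]/(teval idfun w0 (TA t u)) -fE.
  - by move=> _ _ [t ->] [u ->]; rewrite !fE -[RHS]/(teval idfun w0 (TM t u)) -fE.
  - by move=> i _ [t ->]; rewrite !fE -[RHS]/(teval idfun w0 (TD i t)) -fE.
have [T Tmax [subT T0]] := maximal_triple_exists (prime_pair_dhom fA).
have AT z : A z -> Hdom T z by move=> Az; apply: subT; exists (f z == 0).
have phiR c : Hdom T (phi c) by apply: AT; exists (TC c).
have wR k : Hdom T (w k) by apply: AT; exists (TV k).
have xR := val K phi KC phiT T Tmax phiR x Px.
have hT := Htriple_dhom T; have psiT := dhom_comp phiT hT phiR.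
pose h := @Hmap m K T; pose z := sum_coord (h \o x) (h \o w).
have zE t : teval (h \o phi) z t = h (teval phi (sum_coord x w) t).
  rewrite /h (teval_dhom _ hT) //; last by case.
  by apply: eq_teval => // -[].
(* The difference lies in the kernel of [f], which the maximal triple preserves. So in the codomain
   [w] becomes the F-point [w0], and these equations force the F-specialization below to have [w0]
   as its second part. *)
have wE k : h (w k) = h (phi (w0 k)).
  apply/eqP; rewrite -subr_eq0 -(dhomB hT) //; apply/eqP/T0.
  have AB : A (w k - phi (w0 k)).
    by exists (TA (TV k) (TC (- w0 k))); rewrite /= (dhomN phiT).
  split=> //; have := fE (TA (TV k) (TC (- w0 k))); rewrite /= (dhomN phiT) // => ->.
  by rewrite subrr eqxx.
have [|z' _ z'0] := @DCF0_specialize m _ F _ (h \o phi) z (TC 1) FC psiT.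
  by rewrite /= /h (dhom1 phiT) (dhom1 hT); exact/eqP/oner_neq0.
exists (z' \o inl) => t t0.
have -> : pair_coord (z' \o inl) w0 = z'.
  apply: funext => -[i|k] //=.
  have := z'0 (TA (TV (inr k)) (TC (- w0 k))); rewrite /= wE /h (dhomN phiT) // (dhomN hT) //.
  by rewrite subrr => /(_ erefl) /subr0_eq.
by apply: z'0; rewrite zE t0 /h (dhom0 hT).
Qed.

Lemma valuative_complete (m n : nat) (F : diffFieldType m) (P : set (dpoly F 'I_n)) :
  DCF0 F -> valuative P -> dcomplete (dzeros idfun P).
Proof.
move=> FC val N Y [C0 [D0 [[PC0 _ C0E] _ YE]]] Z [Q Qh ZE].
have idT := dhom_idfun F.
have Ynz y : Y y -> exists i, y i <> 0 by rewrite YE C0E => -[[]].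
have Qscale q c x y : Q q -> exists d, deval idfun (pair_coord x (fun i => c * y i)) q
    = c ^+ d * deval idfun (pair_coord x y) q.
  move=> /Qh[d qd]; exists d.
  rewrite -(qd F (idfun : {rmorphism F -> F}) (fun _ _ => erefl)); congr deval.
  by apply: funext => -[].
(* These polynomials define the Kolchin closure of the projection; only its inclusion in the
   projection requires work. *)
pose Pc := [set p : dpoly F 'I_N.+1 | (exists d, dhomog predT d p) /\
  forall y, (snd @` Z) y -> deval idfun y p = 0].
exists ([set y | exists i, y i <> 0] `&` dzeros idfun Pc).
  by exists Pc => // p [].
apply/seteqP; split=> [y Zy|y0 [Yy0 [[j y0j] Cy0]]].
  have Yy : Y y by case: Zy => z; rewrite ZE => -[_ Yz _] <-.
  by split=> //; split; [exact: Ynz|move=> p [_]; apply].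
have {}y0j : y0 j != 0 by exact/eqP.
pose w0 i := y0 i / y0 j.
pose I := {z | Z z /\ z.2 j != 0}.
pose w (z : I) i := (sval z).2 i / (sval z).2 j.
(* By homogenization, w0 lies in the Kolchin closure of the affine chart of snd @` Z. *)
have dense t : teval idfun w0 t <> 0 -> exists z : I, teval idfun (w z) t <> 0.
  move=> tw0; apply: contrapT => nz; apply: tw0.
  have [d [g [gh gE]]] := homogenize j t.
  (* The factor y_j makes the polynomial vanish also at points of the projection outside the
     chart. *)
  have : Pc (dpoly_of_dterm (TM (TV j) g)).
    split=> [|y [z Zz <-]].
      exists d.+1; apply: dhomog_dterm => S phi phiT c y /=.
      by rewrite gh // exprS; ring.
    rewrite deval_idfun_dterm /=; have [->|zj] := eqVneq (z.2 j) 0; first by rewrite mul0r.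
    pose i : I := exist _ z (conj Zz zj).
    rewrite gE // [X in _ * (_ * X)](_ : _ = 0) ?mulr0 //.
    by apply: contrapT => tz; apply: nz; exists i.
  move=> /Cy0; rewrite deval_idfun_dterm /= gE // => /eqP.
  by rewrite !mulf_eq0 expf_eq0 (negPf y0j) andbF => /eqP.
(* Traces on Z of the basic Kolchin neighbourhoods of [w0]; properness is the density just shown. *)
pose G : set_system I := [set B | exists2 t, teval idfun w0 t <> 0 &
  forall z, teval idfun (w z) t <> 0 -> B z].
have GF : ProperFilter G.
  split; first by move=> [t /dense[z tz] /(_ z tz)].
  split=> [|A B [t tw0 tA] [u uw0 uB]|A B AB [t tw0 tA]].
  - by exists (TC 1) => //=; exact/eqP/oner_neq0.
  - exists (TM t u) => /= [|z]; first by apply/eqP; rewrite mulf_neq0 //; apply/eqP.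
    move/eqP; rewrite mulf_eq0 negb_or => /andP[/eqP tz /eqP uz].
    by split; [exact: tA|exact: uB].
  - by exists t => // z /tA /AB.
have [U [UU GU]] := ultraFilterLemma GF.
have [i0 [L [f [fT fU]]]] := @ultraproduct m I (fun=> F) U UU.
have phi0T : dhom_on setT ((fun c _ => c) : F -> dprod (fun=> F) i0).
  by apply: dprod_dhom.
pose phi1 := f \o ((fun c _ => c) : F -> dprod (fun=> F) i0).
have phi1T : dhom_on setT phi1 by exact: dhom_comp phi0T fT _.
have [K [e [KC eT]]] : exists (K : diffFieldType m) (e : L -> K), DCF0 K /\ dhom_on setT e.
  by apply: exists_DCF0; apply: pchar0_dhom phi1T _; case: FC.
pose phi := e \o phi1; have phiT : dhom_on setT phi by exact: dhom_comp phi1T eT _.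
(* The equation criterion of the ultrapower, carried into K by the injective map [e]. *)
have genE (J : Type) (a : J -> I -> F) t :
    teval phi (fun k => e (f (a k : dprod (fun=> F) i0))) t = 0 <->
    U [set z | teval idfun (a^~ z) t = 0].
  rewrite -(teval_dhom (phi := phi1) (x := fun k => f (a k : dprod (fun=> F) i0)) t eT) //.
  rewrite -(teval_dhom (phi := ((fun c _ => c) : F -> dprod (fun=> F) i0))
    (x := fun k => (a k : dprod (fun=> F) i0)) t fT) //.
  rewrite -[X in _ = X](dhom0 eT).
  have -> : [set z | teval idfun (a^~ z) t = 0] = [set z | (teval
      ((fun c _ => c) : F -> dprod (fun=> F) i0) (fun k => (a k : dprod (fun=> F) i0)) t) z = 0].
    by apply/seteqP; split=> z /=; rewrite teval_dprod.
  by rewrite -fU; split=> [/(dhom_inj eT)|->].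
pose x i := e (f ((fun z : I => (sval z).1 i) : dprod (fun=> F) i0)).
pose wK k := e (f ((fun z : I => w z k) : dprod (fun=> F) i0)).
have Px : dzeros phi P x.
  move=> p Pp; rewrite deval_term //; apply/genE; apply: filterS filterT => z _ /=.
  have [+ _] := svalP z; rewrite {1}ZE => -[Xz _ _].
  exact: etrans (esym (deval_term _ idT p)) (Xz p Pp).
(* If t(w0) were nonzero, t(w) would be nonzero on a neighbourhood in [U], hence would not vanish at
   the ultrapower point. *)
have spec t : teval phi wK t = 0 -> teval idfun w0 t = 0.
  move=> /genE Ut; apply: contrapT => tw0.
  have UD : U [set z | teval idfun (w z) t <> 0] by apply: GU; exists t.
  by have [z []] := filter_ex (filterI Ut UD).
have [x1 x1P] := specialization_lift FC val KC phiT Px spec.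
exists (x1, y0) => //; rewrite ZE; split=> //=.
  move=> p Pp; have := x1P (tmap id inl (term_of_dpoly p)); rewrite !teval_tmap => h.
  rewrite deval_term //; apply: h.
  exact: etrans (esym (deval_term x phiT p)) (Px _ Pp).
(* Homogeneity in y turns the affine representative [w0] back into [y0], on scaling by the nonzero
   y0_j. *)
move=> q Qq; have [d] := Qscale q (y0 j) x1 w0 Qq.
have -> : (fun i => y0 j * w0 i) = y0 by apply: funext => i; rewrite /w0 mulrC divfK.
move=> ->; rewrite [X in _ * X](_ : _ = 0) ?mulr0 //.
rewrite deval_term //; apply: x1P.
pose a (s : 'I_n + 'I_N.+1) (z : I) : F := pair_coord (sval z).1 (w z) s.
rewrite (eq_teval (phi' := phi) (x' := fun s => e (f (a s : dprod (fun=> F) i0)))) //; last by case.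
apply/genE; apply: filterS filterT => z _ /=.
rewrite [LHS](_ : _ = deval idfun (pair_coord (sval z).1 (w z)) q); last first.
  by rewrite deval_term //; apply: eq_teval => // -[].
have [Zz zj] := svalP z; have [d'] := Qscale q ((sval z).2 j)^-1 (sval z).1 (sval z).2 Qq.
have -> : (fun i => ((sval z).2 j)^-1 * (sval z).2 i) = w z.
  by apply: funext => i; rewrite mulrC.
move=> ->; move: Zz; rewrite {1}ZE => -[_ _ /(_ q Qq) ->].
by rewrite mulr0.
Qed.

(* X is the zero set of P, a set of Delta-polynomials over F. *)
Theorem theorem4p6 (m n : nat) (F : diffFieldType m) (P : set (dpoly F 'I_n)) :
  DCF0 F ->
  (dcomplete (dzeros idfun P)
   <->
   forall (K : diffFieldType m) (phi : {rmorphism F -> K}),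
     DCF0 K -> dmorphism phi ->
     forall R : set K, maximal_dsubring R -> (forall c : F, R (phi c)) ->
     forall x : 'I_n -> K, dzeros phi P x -> forall i : 'I_n, R (x i)).
Proof.
move=> FC; split=> [Xc K phi _ phid R [T Tmax <-] phiR x Px i|val].
  exact: (complete_valuative FC Xc (dhom_rmorphism phid) Tmax phiR Px).
apply: valuative_complete => // K phi KC phiT T Tmax phiR x Px i.
have [g gd /funext gphi] := rmorphism_of_dhom phiT; subst phi.
by apply: (val K g KC gd (Hdom T)) => //; exists T.
Qed.
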